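(* Let $M$ be a positive integer. For $q\in(1,\infty)$ let $\mathcal U_q'$, $\mathcal V_q'\subset\{0,1,\ldots,M\}^{\mathbb N}$ and $\mathcal U_q,\mathcal V_q\subset\mathbb R$ be the sets defined in the context, and let $\mathcal U,\mathcal V\subset(1,\infty)$ be the sets of bases defined in the context; $\overline{\mathcal U}$ denotes the topological closure of $\mathcal U$ in $\mathbb R$. Consider the four maps $q\mapsto\mathcal U_q'$, $q\mapsto\mathcal U_q$, $q\mapsto\mathcal V_q'$, $q\mapsto\mathcal V_q$ on $(1,\infty)$, where continuity is understood with respect to the Hausdorff distance $d_H$ of the image sets. Then: (i) The functions $q\mapsto\mathcal U_q'$ and $q\mapsto\mathcal U_q$ are left continuous on $(1,\infty)$. (ii) The functions $q\mapsto\mathcal V_q'$ and $q\mapsto\mathcal V_q$ are right continuous on $(1,\infty)$. (iii) Each of the four functions is continuous at $q\in(1,\infty)$ if and only if $q\notin\mathcal V\setminus\overline{\mathcal U}$.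
   Context: Fix a positive integer $M$. A sequence is an element $c=(c_i)_{i=1}^\infty$ of $\{0,1,\ldots,M\}^{\mathbb N}$. This set is a metric space with the distance $\rho(c,c)=0$ and, for $c\neq d$, $\rho(c,d)=2^{-n}$, where $n$ is the smallest index with $c_n\ne d_n$. Sequences are compared in the lexicographic order. The reflection of $(c_i)$ is $\overline{(c_i)}:=(M-c_i)$. A sequence is called infinite if it has infinitely many nonzero digits; by convention the zero sequence $0^\infty$ is also counted as infinite. A sequence is doubly infinite if both it and its reflection are infinite. For real $q>1$ put $(c_i)_q:=\sum_{i=1}^\infty c_i q^{-i}$; the sequence $(c_i)$ is an expansion of $x\in\mathbb R$ in base $q$ (over the alphabet $\{0,1,\ldots,M\}$) if $(c_i)_q=x$. $\mathcal U_q$ is the set of real numbers having exactly one expansion in base $q$, and $\mathcal U_q'$ is the set of the corresponding expansions (sequences). For $1<q\le M+1$, $\alpha(q)$ denotes the quasi-greedy expansion of $1$ in base $q$, i.e. the lexicographically largest infinite expansion of $1$ in base $q$; for $q>M+1$ put $\alpha(q):=M^\infty$. $\mathcal V_q'$ is the set of infinite sequences $(c_i)$ such that for every $n\ge1$: $c_{n+1}c_{n+2}\cdots\le\alpha(q)$ whenever $c_n<M$, and $c_{n+1}c_{n+2}\cdots\ge\overline{\alpha(q)}$ whenever $c_n>0$. $\mathcal V_q:=\{(c_i)_q : (c_i)\in\mathcal V_q'\}$. $\mathcal U$ is the set of bases $q>1$ in which $x=1$ has a unique expansion, and $\mathcal V$ is the set of bases $q>1$ in which $x=1$ has a unique doubly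 infinite expansion. For nonempty subsets $A,B$ of a metric space (here $\{0,\ldots,M\}^{\mathbb N}$ with $\rho$, or $\mathbb R$ with the usual distance), $d_H(A,B)$ is the infimum of the numbers $r>0$ such that $A\subset\bigcup_{x\in B}B_r(x)$ and $B\subset\bigcup_{x\in A}B_r(x)$, where $B_r(x)$ is the open ball of radius $r$ centered at $x$ (the sets need not be closed). A set-valued map $q\mapsto A_q$ is continuous (left continuous, right continuous) at $q$ if $d_H(A_p,A_q)\to0$ as $p\to q$ (as $p\to q$ with $p<q$, as $p\to q$ with $p>q$, respectively). *)

(* Defs.v *)
(* MathComp-Analysis, over an arbitrary [R : realType]. *)
From mathcomp Require Import all_boot all_order all_algebra.
From mathcomp Require Import all_classical all_reals all_analysis.
Import Order.TTheory GRing.Theory Num.Theory.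
Import numFieldNormedType.Exports.

Set Implicit Arguments.
Unset Strict Implicit.
Unset Printing Implicit Defensive.

Local Open Scope classical_set_scope.
Local Open Scope ring_scope.

(* Sequences (c_i)_{i >= 1} over {0, ..., M} are indexed from 0 here:
   [c i] is the digit c_{i+1}, whence the shifts by one below. *)
Definition digits (M : nat) : Type := nat -> 'I_M.+1.

Definition shift (M k : nat) (c : digits M) : digits M := fun i => c (k + i)%N.

(* [rev_ord] on ['I_M.+1] is k |-> M - k. *)
Definition reflection (M : nat) (c : digits M) : digits M :=
  fun i => rev_ord (c i).

Definition lex_lt (M : nat) (c d : digits M) : Prop :=
  exists n, (forall i, (i < n)%N -> c i = d i) /\ (c n < d n)%N.

Definition lex_le (M : nat) (c d : digits M) : Prop := c = d \/ lex_lt c d.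

Definition seq_infinite (M : nat) (c : digits M) : Prop :=
  c = (fun=> ord0) \/ forall n, exists2 m, (n <= m)%N & c m != ord0.

Definition doubly_infinite (M : nat) (c : digits M) : Prop :=
  seq_infinite c /\ seq_infinite (reflection c).

Definition rho (R : realType) (M : nat) (c d : digits M) : R :=
  if pselect (exists n, c n != d n) is left neq_cd
  then 2 ^- (ex_minn neq_cd).+1 else 0.

(* The series converges for q > 1, the only bases considered. *)
Definition expansion_value (R : realType) (M : nat) (q : R) (c : digits M) : R :=
  limn (series (fun i => (c i : nat)%:R * q ^- i.+1)).

Definition univoque_set (R : realType) (M : nat) (q : R) : set R :=
  [set x | exists! c : digits M, expansion_value q c = x].

Definition univoque_seqs (R : realType) (M : nat) (q : R) : set (digits M) :=
  [set c | univoque_set M q (expansion_value q c)].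
Arguments univoque_seqs {R} M q _.

Definition is_quasi_greedy (R : realType) (M : nat) (q : R) (a : digits M) :
    Prop :=
  [/\ seq_infinite a, expansion_value q a = 1 &
      forall c : digits M,
        seq_infinite c -> expansion_value q c = 1 -> lex_le c a].

(* For 1 < q <= M + 1 exactly one sequence satisfies [is_quasi_greedy q], so
   the default value of [xget] plays no role there. *)
Definition alpha (R : realType) (M : nat) (q : R) : digits M :=
  if q <= M.+1%:R then xget (fun=> ord_max) [set a | is_quasi_greedy q a]
  else fun=> ord_max.

Definition V_seqs (R : realType) (M : nat) (q : R) : set (digits M) :=
  [set c | seq_infinite c /\
    forall n,
      ((c n < M)%N -> lex_le (shift n.+1 c) (alpha M q)) /\
      ((0 < c n)%N -> lex_le (reflection (alpha M q)) (shift n.+1 c))].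
Arguments V_seqs {R} M q _.

Definition V_set (R : realType) (M : nat) (q : R) : set R :=
  [set expansion_value q c | c in V_seqs M q].

Definition univoque_bases (R : realType) (M : nat) : set R :=
  [set q | 1 < q /\ exists! c : digits M, expansion_value q c = 1].

Definition V_bases (R : realType) (M : nat) : set R :=
  [set q | 1 < q /\
    exists! c : digits M, doubly_infinite c /\ expansion_value q c = 1].

(* Extended-real valued: the infimum of the empty set is +oo. *)
Definition hausdorff_dist (R : realType) (T : Type) (dist : T -> T -> R)
    (A B : set T) : \bar R :=
  ereal_inf [set r%:E | r in [set r : R | 0 < r /\
    A `<=` \bigcup_(x in B) [set y | dist x y < r] /\
    B `<=` \bigcup_(x in A) [set y | dist x y < r]]].

Definition real_dist (R : realType) (x y : R) : R := `|x - y|.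

(* Only bases p close to q matter, hence only p > 1 when q > 1. *)
Definition hausdorff_continuous_at (R : realType) (T : Type)
    (dist : T -> T -> R) (A : R -> set T) (q : R) : Prop :=
  hausdorff_dist dist (A p) (A q) @[p --> q^'] --> 0%E.

Definition hausdorff_left_continuous_at (R : realType) (T : Type)
    (dist : T -> T -> R) (A : R -> set T) (q : R) : Prop :=
  hausdorff_dist dist (A p) (A q) @[p --> q^'-] --> 0%E.

Definition hausdorff_right_continuous_at (R : realType) (T : Type)
    (dist : T -> T -> R) (A : R -> set T) (q : R) : Prop :=
  hausdorff_dist dist (A p) (A q) @[p --> q^'+] --> 0%E.

(* Main.v *)
Require Import Defs.
From mathcomp Require Import all_boot all_order all_algebra.
From mathcomp Require Import all_classical all_reals all_analysis.
From mathcomp Require Import ring lra zify.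
Import Order.TTheory GRing.Theory Num.Theory.
Import numFieldNormedType.Exports.

(** For bases [q <= M + 1] write [a] for the quasi-greedy expansion [alpha M q]
    of 1. The sequences of the two families are described by the values of their
    tails: [c] is univoque in base [q] when every tail of [c] that follows a
    digit below [M] has value less than 1, and the same holds for the reflection
    of [c] ([univoque_seqsP]); for [V_seqs] the value is at most 1 and [c] is
    infinite ([V_seqsP]). As the value of a sequence strictly decreases in the
    base, both families grow with the base and are interleaved: [V_seqs] at [p]
    lies in the univoque sequences at every [q > p]. Hausdorff continuity
    therefore only asks that the larger sets be approximated, up to any number
    of common digits, by elements of the smaller ones ([close_along]); the maps
    with values in the reals follow because the value is uniformly continuous.

    From the right, for [q < M + 1], [V_seqs] at [q] is the intersection of the
    compact sets [V_seqs] at [p > q], since the value conditions are closed in the base and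
    in the sequence; hence [V_right]. Everything else is approximation from
    below: which sequences at [q] are limits of sequences univoque in some base
    below [q]. A sequence whose relevant tails all fall below [a] within [m]
    digits, for a fixed [m], is itself univoque in such a base
    ([tails_lt_in_univoque]). Three cases arise ([alpha_cases]).

    If a tail of the reflection of [a], following a digit below [M], has value
    above 1, then [q] is not in [V_bases], and long prefixes of [a] do not occur in
    sequences of [V_seqs] at all, so that every such sequence is univoque below
    [q].

    If [a] reproduces its own reflection after [k.+1] digits ([periodic_base]),
    a univoque sequence cannot contain the first [k.+1] digits of [a] after a
    digit below [M]: thus univoque sequences are again univoque below [q]. But
    [a], which is in [V_seqs], is isolated from them, by common digits as well
    as by value. As [a] becomes univoque in every base above [q], while [V_seqs]
    at smaller bases consists of sequences univoque at [q], the univoque maps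
    jump on the right of [q] and the other two on the left. The same gap shows
    that no base near [q] lies in [univoque_bases]. So the bases of this case
    are those of [V_bases] outside the closure of [univoque_bases]
    ([periodic_base_iff]).

    In the remaining case every tail of the reflection of [a] is strictly below
    [a]. Then [a] has arbitrarily long prefixes [v] none of whose reflected
    suffixes is a prefix of [a] ([good_prefixes]). Let [w] be [v] with its last
    digit decreased. A sequence of [V_seqs] is cut before the first relevant
    occurrence of [v] or of its reflection, and continued by [w w w ...] or by
    its reflection; the result is univoque below [q] ([lowered_approx]). Finally
    [v], followed by the reflection of [w w w ...], is the unique expansion of 1
    in a base close to [q], so that [q] is in the closure of [univoque_bases]
    ([alpha_strict_closure]). *)

Set Implicit Arguments.
Unset Strict Implicit.
Unset Printing Implicit Defensive.

Local Open Scope classical_set_scope.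
Local Open Scope ring_scope.

Local Notation shift := Defs.shift.
Arguments reflection : simpl never.
Arguments Defs.shift : simpl never.

(** * Values of expansions *)

Lemma expansion_term_le (R : realType) M (q : R) (c : digits M) i : 1 < q ->
  (c i : nat)%:R * q ^- i.+1 <= M%:R * q ^- i.+1.
Proof.
move=> q1; rewrite ler_wpM2r ?invr_ge0 ?exprn_ge0 ?(le_trans ler01 (ltW q1))//.
by rewrite ler_nat -ltnS.
Qed.

Lemma cvg_full_series (R : realType) M (q : R) : 1 < q ->
  series (fun i => M%:R * q ^- i.+1) x @[x --> \oo] --> (M%:R / (q - 1)).
Proof.
move=> q1; have q0 : 0 < q by apply: lt_trans q1.
have -> : (fun i => M%:R * q ^- i.+1) = geometric (M%:R / q) q^-1.
  by apply/funext => i; rewrite /geometric/= exprS invfM exprVn mulrA.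
have -> : M%:R / (q - 1) = M%:R / q / (1 - q^-1).
  by field; rewrite !subr_eq0 !gt_eqF//=.
by apply: cvg_geometric_series; rewrite ger0_norm ?invr_ge0 ?ltW// invf_lt1.
Qed.

Lemma is_cvg_expansion (R : realType) M (q : R) (c : digits M) : 1 < q ->
  cvgn (series (fun i => (c i : nat)%:R * q ^- i.+1)).
Proof.
move=> q1; have q0 : 0 < q by apply: lt_trans q1.
apply: (@series_le_cvg _ _ (fun i => M%:R * q ^- i.+1)).
- by move=> n; rewrite mulr_ge0// invr_ge0 exprn_ge0 ?ltW.
- by move=> n; rewrite mulr_ge0// invr_ge0 exprn_ge0 ?ltW.
- by move=> n; exact: expansion_term_le.
- by apply: cvgP; exact: cvg_full_series.
Qed.

Lemma expansion_value_ge0 (R : realType) M (q : R) (c : digits M) : 1 < q ->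
  0 <= expansion_value q c.
Proof.
move=> q1; apply: limr_ge; first exact: is_cvg_expansion.
apply: nearW => n; apply: sumr_ge0 => i _.
by rewrite mulr_ge0// invr_ge0 exprn_ge0// ltW// (lt_trans _ q1).
Qed.

Lemma expansion_value_rec (R : realType) M (q : R) (c : digits M) : 1 < q ->
  expansion_value q c =
  ((c 0%N : nat)%:R + expansion_value q (shift 1 c)) / q.
Proof.
move=> q1; have q0 : 0 < q by apply: lt_trans q1.
apply/cvg_lim => //; rewrite -cvg_shiftS.
have -> : (fun n => series (fun i => (c i : nat)%:R * q ^- i.+1) n.+1) =
  (fun n => ((c 0%N : nat)%:R +
     series (fun i => (shift 1 c i : nat)%:R * q ^- i.+1) n) / q).
  apply/funext => n; rewrite /series/= big_nat_recl//= expr1 mulrDl.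
  congr (_ + _); rewrite big_distrl/=; apply: eq_bigr => i _.
  by rewrite /shift add1n (exprS q i.+1) invfM [q^-1 * _]mulrC mulrA.
apply: cvgMl; apply: cvgD; first exact: cvg_cst.
exact: is_cvg_expansion.
Qed.

Lemma reflectionK M : involutive (@reflection M).
Proof. by move=> c; apply/funext => i; rewrite /reflection rev_ordK. Qed.

Lemma reflection_val M (c : digits M) i : (reflection c i = M - c i :> nat)%N.
Proof. by rewrite /reflection/= subSS. Qed.

Lemma expansion_value_reflection (R : realType) M (q : R) (c : digits M) :
  1 < q ->
  expansion_value q (reflection c) = M%:R / (q - 1) - expansion_value q c.
Proof.
move=> q1; apply/cvg_lim => //.
have -> : series (fun i => (reflection c i : nat)%:R * q ^- i.+1) =
  (fun n => series (fun i => M%:R * q ^- i.+1) n -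
     series (fun i => (c i : nat)%:R * q ^- i.+1) n).
  apply/funext => n; rewrite /series/= -sumrB; apply: eq_bigr => i _.
  rewrite subSS -mulrBl natrB//.
  by rewrite -ltnS.
by apply: cvgB; [exact: cvg_full_series|exact: is_cvg_expansion].
Qed.

Lemma expansion_value_le (R : realType) M (q : R) (c : digits M) : 1 < q ->
  expansion_value q c <= M%:R / (q - 1).
Proof.
move=> q1; rewrite -subr_ge0 -expansion_value_reflection//.
exact: expansion_value_ge0.
Qed.

(** * Common prefixes, first differences and change of base *)

Lemma shift_shift M m n (c : digits M) : shift m (shift n c) = shift (n + m) c.
Proof. by apply/funext => i; rewrite /Defs.shift addnA. Qed.

Lemma shiftS M n (c : digits M) : shift 1 (shift n c) = shift n.+1 c.
Proof. by rewrite shift_shift addn1. Qed.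

Lemma shift0_digits M (c : digits M) : shift 0 c = c.
Proof. by []. Qed.

Lemma shift_reflection M n (c : digits M) :
  shift n (reflection c) = reflection (shift n c).
Proof. by []. Qed.

Definition agree M n (x y : digits M) := forall i, (i < n)%N -> x i = y i.

Lemma agree_sym M n (x y : digits M) : agree n x y -> agree n y x.
Proof. by move=> xy i /xy. Qed.

Lemma agree_trans M n (x y z : digits M) :
  agree n x y -> agree n y z -> agree n x z.
Proof. by move=> xy yz i i_n; rewrite xy ?yz. Qed.

Lemma agree_le M m n (x y : digits M) :
  (m <= n)%N -> agree n x y -> agree m x y.
Proof. by move=> mn xy i im; apply: xy; apply: leq_trans mn. Qed.

Lemma agree_reflection M n (x y : digits M) :
  agree n x y -> agree n (reflection x) (reflection y).
Proof. by move=> xy i i_n; rewrite /reflection xy. Qed.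

Lemma agree_shift M n k (x y : digits M) :
  agree (k + n) x y -> agree n (shift k x) (shift k y).
Proof. by move=> xy i i_n; rewrite /Defs.shift xy// ltn_add2l. Qed.

Lemma exprV_small (R : realType) (q b e : R) : 1 < q -> 0 < e ->
  exists n, b * q ^- n < e.
Proof.
move=> q1 e0; have q0 : 0 < q by apply: lt_trans q1.
have : geometric b q^-1 n @[n --> \oo] --> (0 : R).
  by apply: cvg_geometric; rewrite ger0_norm ?invr_ge0 ?ltW// invf_lt1.
move/cvgrPdist_lt => /(_ e e0)[N _ /(_ N (leqnn _))] H.
exists N; move: H; rewrite /geometric/= sub0r normrN exprVn.
exact/le_lt_trans/ler_norm.
Qed.

Lemma expansion_value_agree (R : realType) M (q : R) n (c d : digits M) :
  1 < q -> agree n c d ->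
  expansion_value q c - expansion_value q d =
  q ^- n * (expansion_value q (shift n c) - expansion_value q (shift n d)).
Proof.
move=> q1; have q0 : q != 0 by rewrite gt_eqF// (lt_trans _ q1).
elim: n => [|n IH] cd; first by rewrite expr0 invr1 mul1r.
rewrite IH; last exact: agree_le cd.
rewrite (expansion_value_rec (shift n c))// (expansion_value_rec (shift n d))//.
rewrite !shiftS.
have -> : shift n c 0 = shift n d 0 by rewrite /Defs.shift addn0 cd.
rewrite exprS.
by field; rewrite q0 expf_neq0.
Qed.

Lemma expansion_value_dist (R : realType) M (q : R) n (c d : digits M) :
  1 < q -> agree n c d ->
  `|expansion_value q c - expansion_value q d| <= M%:R / (q - 1) * q ^- n.
Proof.
move=> q1 cd; rewrite (expansion_value_agree q1 cd) normrM mulrC.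
have qn : 0 <= q ^- n by rewrite invr_ge0 exprn_ge0// ltW// (lt_trans _ q1).
rewrite (ger0_norm qn); apply: ler_wpM2r => //.
have := expansion_value_ge0 (shift n c) q1.
have := expansion_value_ge0 (shift n d) q1.
have := expansion_value_le (shift n c) q1.
have := expansion_value_le (shift n d) q1.
by move=> *; rewrite ler_norml; apply/andP; split; lra.
Qed.

Definition lt_at M k (x y : digits M) := agree k x y /\ (x k < y k)%N.

(** One unit at the first difference outweighs everything that follows when the
    tail of [x] has value at most 1: this turns lexicographic comparisons into
    comparisons of values, with an explicit gap. *)
Lemma first_difference (R : realType) M (q : R) k (x a : digits M) : 1 < q ->
  lt_at k x a ->
  expansion_value q x <= expansion_value q a +
    q ^- k.+1 * (expansion_value q (shift k.+1 x) - 1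
                 - expansion_value q (shift k.+1 a)).
Proof.
move=> q1 [xa ltk]; have q0 : 0 < q by apply: lt_trans q1.
rewrite -lerBlDl (expansion_value_agree q1 xa).
rewrite (expansion_value_rec (shift k x))// (expansion_value_rec (shift k a))//.
have EAB A B : q ^- k * (A / q - B / q) = q ^- k.+1 * (A - B).
  by rewrite exprS invfM; ring.
rewrite !shiftS EAB ler_wpM2l ?invr_ge0 ?exprn_ge0 ?(ltW q0)//.
rewrite {1 3}/Defs.shift addn0.
have : (x k : nat)%:R + 1 <= (a k : nat)%:R :> R by rewrite natr1 ler_nat.
lra.
Qed.

Lemma first_difference_le (R : realType) M (q : R) k (x a : digits M) : 1 < q ->
  lt_at k x a -> expansion_value q (shift k.+1 x) <= 1 ->
  expansion_value q x <=
    expansion_value q a - q ^- k.+1 * expansion_value q (shift k.+1 a).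
Proof.
move=> q1 xa x1; apply: (le_trans (first_difference q1 xa)).
rewrite -mulrN lerD2l ler_wpM2l ?invr_ge0 ?exprn_ge0 ?(ltW (lt_trans _ q1))//.
by lra.
Qed.

Lemma expansion_value_ge_tail (R : realType) M (q : R) n (c : digits M) :
  1 < q -> q ^- n * expansion_value q (shift n c) <= expansion_value q c.
Proof.
move=> q1; have q0 : 0 < q by apply: lt_trans q1.
elim: n => [|n IH]; first by rewrite expr0 invr1 mul1r.
apply: le_trans IH.
have -> : q ^- n.+1 * expansion_value q (shift n.+1 c) =
    q ^- n * (expansion_value q (shift n.+1 c) / q).
  by rewrite exprS invfM; ring.
rewrite ler_wpM2l ?invr_ge0 ?exprn_ge0 ?(ltW q0)//.
rewrite (expansion_value_rec (shift n c))// shiftS.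
by rewrite ler_wpM2r ?invr_ge0 ?(ltW q0)// lerDr.
Qed.

Lemma expansion_value_gt0 (R : realType) M (q : R) n (c : digits M) :
  1 < q -> c n != ord0 -> 0 < expansion_value q c.
Proof.
move=> q1 cn; have q0 : 0 < q by apply: lt_trans q1.
apply: lt_le_trans (expansion_value_ge_tail n c q1).
rewrite mulr_gt0 ?invr_gt0 ?exprn_gt0// expansion_value_rec//.
rewrite divr_gt0// ltr_pwDl ?expansion_value_ge0//.
by rewrite /Defs.shift addn0 ltr0n lt0n.
Qed.

Lemma expansion_value0 (R : realType) M (q : R) :
  1 < q -> expansion_value q ((fun=> ord0) : digits M) = 0.
Proof.
move=> q1; apply/cvg_lim => //.
have -> : series (fun i => (((fun=> ord0) : digits M) i : nat)%:R * q ^- i.+1) =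
  fun=> 0.
  by apply/funext => n; rewrite /series/= big1// => i _; rewrite mul0r.
exact: cvg_cst.
Qed.

Lemma expansion_value_eq0 (R : realType) M (q : R) (c : digits M) :
  1 < q -> expansion_value q c = 0 -> c = (fun=> ord0).
Proof.
move=> q1 c0; apply/funext => n; apply/eqP/negP => /negP cn.
by have := expansion_value_gt0 q1 cn; rewrite c0 ltxx.
Qed.

(** Termwise, because [(p / q) ^+ i.+1 <= p / q]; the factor [p / q] makes the
    monotonicity in the base strict. *)
Lemma expansion_value_base_le (R : realType) M (p q : R) (c : digits M) :
  1 < p -> p <= q ->
  expansion_value q c <= p / q * expansion_value p c.
Proof.
move=> p1 pq; have p0 : 0 < p by apply: lt_trans p1.
have q0 : 0 < q by apply: lt_le_trans pq.
have q1 : 1 < q by apply: lt_le_trans pq.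
pose f (t : R) := fun i => (c i : nat)%:R * t ^- i.+1.
have -> : p / q * expansion_value p c =
    limn (fun n => p / q * series (f p) n).
  by apply/esym/cvg_lim => //; apply: cvgMr; exact: is_cvg_expansion.
apply: ler_lim.
- exact: is_cvg_expansion.
- by apply: is_cvgMr; exact: is_cvg_expansion.
- apply: nearW => n; rewrite /series/= big_distrr/=; apply: ler_sum => i _.
  rewrite mulrCA ler_wpM2l// ler_pdivlMr ?exprn_gt0//.
  have -> : q ^- i.+1 * p ^+ i.+1 = (p / q) ^+ i.+1.
    by rewrite exprMn exprVn mulrC.
  rewrite exprS ler_piMr ?divr_ge0 ?(ltW p0) ?(ltW q0)//.
  rewrite exprn_ile1 ?divr_ge0 ?(ltW p0) ?(ltW q0)//.
  by rewrite ler_pdivrMr ?mul1r.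
Qed.

Lemma expansion_value_decr (R : realType) M (p q : R) (c : digits M) :
  1 < p -> p < q -> 0 < expansion_value p c ->
  expansion_value q c < expansion_value p c.
Proof.
move=> p1 pq c0; have p0 : 0 < p by apply: lt_trans p1.
apply: (le_lt_trans (expansion_value_base_le c p1 (ltW pq))).
by rewrite gtr_pMl// ltr_pdivrMr ?mul1r// (lt_trans p0).
Qed.

Lemma expansion_value_nincr (R : realType) M (p q : R) (c : digits M) :
  1 < p -> p <= q -> expansion_value q c <= expansion_value p c.
Proof.
move=> p1 pq; have p0 : 0 < p by apply: lt_trans p1.
have q0 : 0 < q by apply: lt_le_trans pq.
apply: (le_trans (expansion_value_base_le c p1 pq)).
by rewrite ler_piMl ?expansion_value_ge0// ler_pdivrMr ?mul1r.
Qed.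

(** A sequence and its reflection both lose value when the base grows, and their
    values add up to [M / (q - 1)]. This bounds the loss by a modulus common to
    all sequences. *)
Lemma expansion_value_base_dist (R : realType) M (p q : R) (c : digits M) :
  1 < p -> p <= q ->
  expansion_value p c - expansion_value q c <= M%:R / (p - 1) - M%:R / (q - 1).
Proof.
move=> p1 pq; have q1 : 1 < q by apply: lt_le_trans pq.
have := expansion_value_nincr (reflection c) p1 pq.
rewrite !expansion_value_reflection//; lra.
Qed.

Lemma expansion_value_cvg (R : realType) M (q : R) : 1 < q ->
  M%:R / (p - 1) @[p --> q] --> (M%:R / (q - 1) : R).
Proof.
move=> q1; apply: cvgMr; apply: cvgV; first by rewrite subr_eq0 gt_eqF.
by apply: cvgB; [exact: cvg_id|exact: cvg_cst].
Qed.

Lemma expansion_value_near (R : realType) M (q e : R) : 1 < q -> 0 < e ->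
  \forall p \near q, 1 < p /\ forall c : digits M,
    `|expansion_value p c - expansion_value q c| < e.
Proof.
move=> q1 e0.
have /cvgrPdist_lt/(_ e e0) := @expansion_value_cvg _ M _ q1.
move=> near_e; near=> p.
have p1 : 1 < p by near: p; exact: lt_nbhsr.
split=> // c.
have : `|M%:R / (q - 1) - M%:R / (p - 1)| < e by near: p.
have [pq|/ltW qp] := leP p q.
- have := expansion_value_nincr c p1 pq.
  have := expansion_value_base_dist c p1 pq.
  by rewrite !ltr_norml; lra.
- have := expansion_value_nincr c q1 qp.
  have := expansion_value_base_dist c q1 qp.
  by rewrite !ltr_norml; lra.
Unshelve. all: by end_near. Qed.

Lemma expansion_value_continuous (R : realType) M (c : digits M) (q : R) :
  1 < q -> {for q, continuous (fun p => expansion_value p c)}.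
Proof.
move=> q1; apply/cvgrPdist_lt => e e0.
by apply: filterS (expansion_value_near M q1 e0) => p [_]; rewrite distrC; exact.
Qed.

(** * Quasi-greedy expansions *)

Lemma quasi_greedy_digit (R : realType) M (y : R) :
  exists d : 'I_M.+1, 0 < y ->
    (d : nat)%:R < y /\ ((d < M)%N -> y <= (d : nat)%:R + 1).
Proof.
have [My|yM] := ltP M%:R y.
  by exists ord_max => _; split=> //=; rewrite ltnn.
have ex_n : exists n : nat, y <= n%:R by exists M.
case: (ex_minnP ex_n) => -[y0 _|n yn min_n].
  by exists ord0 => /lt_le_trans/(_ y0); rewrite ltxx.
have nM : (n < M.+1)%N by apply: ltnW; exact: min_n.
exists (Ordinal nM) => _; split=> /=; last by rewrite natr1.
rewrite ltNge; apply/negP => /min_n; by rewrite ltnn.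
Qed.

(** The recursion contracts distances by the factor [q], so it has at most one
    bounded solution. *)
Lemma expansion_value_unique (R : realType) M (q : R) (c : digits M)
    (y : nat -> R) : 1 < q ->
  (forall n, 0 <= y n <= M%:R / (q - 1)) ->
  (forall n, y n = ((c n : nat)%:R + y n.+1) / q) ->
  forall n, expansion_value q (shift n c) = y n.
Proof.
move=> q1 y_bd y_rec n; have q0 : 0 < q by apply: lt_trans q1.
have close k : forall n, `|expansion_value q (shift n c) - y n| <=
    M%:R / (q - 1) * q ^- k.
  elim: k => [|k IH] m.
    have /andP[? ?] := y_bd m.
    have := expansion_value_ge0 (shift m c) q1.
    have := expansion_value_le (shift m c) q1.
    by rewrite expr0 invr1 mulr1 ler_norml => *; apply/andP; split; lra.
  rewrite expansion_value_rec// shiftS y_rec /Defs.shift addn0 -mulrBl opprD.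
  rewrite addrACA subrr add0r normrM (gtr0_norm (_ : 0 < q^-1)) ?invr_gt0//.
  by rewrite exprSr invfM mulrA ler_wpM2r ?invr_ge0 ?(ltW q0)//; exact: IH.
apply/eqP; rewrite -subr_eq0; apply: contraT; rewrite -normr_gt0 => e0.
have [k /lt_le_trans/(_ (close k n))] := exprV_small (M%:R / (q - 1)) q1 e0.
by rewrite ltxx.
Qed.

(** The condition that makes an infinite expansion quasi-greedy. Stated on
    values, it is closed in [c] and in [q], and becomes strict when [q] grows. *)
Definition tails_le (R : realType) M (q : R) (c : digits M) :=
  forall n, (c n < M)%N -> expansion_value q (shift n.+1 c) <= 1.

Definition tails_lt (R : realType) M (q : R) (c : digits M) :=
  forall n, (c n < M)%N -> expansion_value q (shift n.+1 c) < 1.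

(** The algorithm takes at each step the largest digit that leaves a positive
    remainder. Since [1 <= M / (q - 1)], all remainders stay in the interval
    where expansions exist. *)
Lemma quasi_greedy_exists (R : realType) M (q x : R) :
  1 < q -> q <= M.+1%:R -> 0 < x -> x <= M%:R / (q - 1) ->
  exists c : digits M, [/\ expansion_value q c = x, tails_le q c &
    forall n, 0 < expansion_value q (shift n c)].
Proof.
move=> q1 qM x0 xM; have q0 : 0 < q by apply: lt_trans q1.
have q10 : 0 < q - 1 by rewrite subr_gt0.
have M1 : 1 <= M%:R / (q - 1).
  by rewrite ler_pdivlMr// mul1r lerBlDr natr1.
have [d dP] := choice (@quasi_greedy_digit R M).
pose y := fun n => iter n (fun t => q * t - (d (q * t) : nat)%:R) x.
have yS n : y n.+1 = q * y n - (d (q * y n) : nat)%:R by [].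
have y_bd n : 0 < y n /\ y n <= M%:R / (q - 1).
  elim: n => [//|n [y0 yM]]; rewrite yS.
  have [dy dM] := dP _ (mulr_gt0 q0 y0); split; first by rewrite subr_gt0.
  have [/dM|Md] := ltnP (d (q * y n)) M.
    by move=> ?; apply: le_trans M1; lra.
  have -> : (d (q * y n) : nat) = M by apply/eqP; rewrite eqn_leq Md -ltnS andbT.
  have : q * y n <= q * (M%:R / (q - 1)) by rewrite ler_pM2l.
  have : M%:R / (q - 1) = q * (M%:R / (q - 1)) - M%:R.
    by field; rewrite gt_eqF.
  move: (M%:R / (q - 1)) => B BE le_B; rewrite BE; lra.
pose c : digits M := fun n => d (q * y n).
have cE : forall n, expansion_value q (shift n c) = y n.
  apply: expansion_value_unique => // n.
    by have [/ltW -> ->] := y_bd n.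
  by rewrite yS /c addrC subrK mulrC mulKf// gt_eqF.
exists c; split.
- exact: (cE 0%N).
- move=> n cn; rewrite cE yS lerBlDl.
  by apply: (dP _ (mulr_gt0 q0 (y_bd n).1)).2.
- by move=> n; rewrite cE; exact: (y_bd n).1.
Qed.

Lemma lex_trichotomy M (x y : digits M) :
  [\/ x = y, exists k, lt_at k x y | exists k, lt_at k y x].
Proof.
have [->|/eqP xy] := pselect (x = y); first by constructor 1.
have ex_k : exists k, x k != y k.
  apply: contrapT => nex; move/eqP: xy; apply; apply/funext => k.
  by apply/eqP/negP => /negP xyk; apply: nex; exists k.
case: (ex_minnP ex_k) => k xyk min_k.
have agr : agree k x y.
  by move=> i ik; apply/eqP; apply: contraLR ik => /min_k; rewrite leqNgt.
case: (ltngtP (x k) (y k)) => [xyk'|yxk|/val_inj xyE].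
- by constructor 2; exists k.
- by constructor 3; exists k; split=> //; exact: agree_sym.
- by rewrite xyE eqxx in xyk.
Qed.

Lemma lt_at_asym M k j (x y : digits M) : lt_at k x y -> lt_at j y x -> False.
Proof.
move=> [xy ltk] [yx ltj]; case: (ltngtP k j) => [kj|jk|kj].
- by rewrite yx// ltnn in ltk.
- by rewrite xy// ltnn in ltj.
- by move: ltj; rewrite -kj ltnNge ltnW.
Qed.

Lemma lex_le_lt_at M k (x y : digits M) : lex_le x y -> ~ lt_at k y x.
Proof.
move=> [->|[j xy]]; first by move=> [_]; rewrite ltnn.
exact: lt_at_asym xy.
Qed.

Lemma lex_leP M (x y : digits M) : (forall k, ~ lt_at k y x) -> lex_le x y.
Proof.
move=> nlt; case: (lex_trichotomy x y) => [->|xy|[k /nlt]//]; first by left.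
by right.
Qed.

Lemma lex_le_anti M (x y : digits M) : lex_le x y -> lex_le y x -> x = y.
Proof.
by move=> xy [//|[k /(lex_le_lt_at xy)]].
Qed.

(** The zero sequence counts as infinite, so one nonzero digit has to be given. *)
Lemma infinite_tail_gt0 (R : realType) M (q : R) (c : digits M) n k : 1 < q ->
  seq_infinite c -> c k != ord0 -> 0 < expansion_value q (shift n c).
Proof.
move=> q1 [->|/(_ n)[m nm cm]]; first by rewrite eqxx.
move=> _; apply: (@expansion_value_gt0 _ _ _ (m - n)%N) => //.
by rewrite /Defs.shift subnKC.
Qed.

Lemma tail_gt0_infinite (R : realType) M (q : R) (c : digits M) : 1 < q ->
  (forall n, 0 < expansion_value q (shift n c)) -> seq_infinite c.
Proof.
move=> q1 cpos; right=> n; apply: contrapT => nex.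
have := cpos n; have -> : shift n c = fun=> ord0.
  apply/funext => i; apply/eqP/negP => /negP ci; apply: nex.
  by exists (n + i)%N; rewrite ?leq_addr.
by rewrite expansion_value0// ltxx.
Qed.

(** If [d] were lexicographically larger, its digit at the first difference
    would exceed that of [a] by a unit, worth at least the whole tail of [a],
    and the infinite sequence [d] still has a nonzero tail. *)
Lemma value_le_lex_le (R : realType) M (q : R) (d a : digits M) : 1 < q ->
  tails_le q a -> seq_infinite d ->
  expansion_value q d <= expansion_value q a -> lex_le d a.
Proof.
move=> q1 a_le d_inf da; apply: lex_leP => k adk.
have aM : (a k < M)%N by apply: leq_trans adk.2 _; rewrite -ltnS.
have := first_difference_le q1 adk (a_le k aM).
have : 0 < expansion_value q (shift k.+1 d).
  apply: (@infinite_tail_gt0 _ _ _ _ _ k) => //.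
  by apply: contraTneq adk.2 => ->; rewrite ltn0.
move=> d0; have : 0 < q ^- k.+1 * expansion_value q (shift k.+1 d).
  by rewrite mulr_gt0// invr_gt0 exprn_gt0// (lt_trans _ q1).
lra.
Qed.

Lemma full_value_eq (R : realType) M (q : R) (c : digits M) : 1 < q ->
  expansion_value q c = M%:R / (q - 1) -> c = fun=> ord_max.
Proof.
move=> q1 cM; rewrite -(reflectionK c).
have /expansion_value_eq0 -> // : expansion_value q (reflection c) = 0.
  by rewrite expansion_value_reflection// cM subrr.
by apply/funext => i; apply: val_inj => /=; rewrite subn1.
Qed.

Lemma alphaP (R : realType) M (q : R) : 1 < q -> q <= M.+1%:R ->
  [/\ expansion_value q (alpha M q) = 1, tails_le q (alpha M q) &
    forall n, 0 < expansion_value q (shift n (alpha M q))].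
Proof.
move=> q1 qM.
have [||a [a1 a_le a_pos]] := @quasi_greedy_exists R M q 1 q1 qM => //.
  by rewrite ler_pdivlMr ?subr_gt0// mul1r lerBlDr natr1.
have aqg : is_quasi_greedy q a.
  split=> //; first exact: tail_gt0_infinite a_pos.
  by move=> d d_inf d1; apply: value_le_lex_le q1 a_le d_inf _; rewrite a1 d1.
suff -> : alpha M q = a by [].
rewrite /alpha qM; case: xgetP => [b _ bqg|/(_ a)//].
have [[a_inf _ a_max] [b_inf b1 b_max]] := (aqg, bqg).
by apply: lex_le_anti; [exact: a_max|exact: b_max].
Qed.

Lemma alpha_full (R : realType) M (q : R) : 1 < q -> M.+1%:R <= q ->
  alpha M q = fun=> ord_max.
Proof.
move=> q1; rewrite le_eqVlt => /predU1P[qE|Mq]; last first.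
  by rewrite /alpha leNgt Mq.
have [|a1 _ _] := @alphaP R M q q1; first by rewrite -qE.
apply: (full_value_eq q1); rewrite a1 -qE -natr1 addrK divff//.
by move: q1; rewrite -qE -natr1 => M0; rewrite gt_eqF; lra.
Qed.

(** * Univoque sequences and V-sequences through the values of tails *)

Lemma reflection_lt M (c : digits M) n :
  (reflection c n < M)%N = (0 < c n)%N.
Proof. by rewrite reflection_val; have := ltn_ord (c n); lia. Qed.

Lemma lt_at_reflection M k (x y : digits M) :
  lt_at k x y -> lt_at k (reflection y) (reflection x).
Proof.
move=> [xy ltk]; split; first by apply: agree_reflection; exact: agree_sym.
by rewrite !reflection_val; have := ltn_ord (y k); lia.
Qed.

Lemma lex_le_reflection M (x y : digits M) :
  lex_le x y -> lex_le (reflection y) (reflection x).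
Proof.
move=> xy; apply: lex_leP => k /lt_at_reflection.
by rewrite !reflectionK; exact: lex_le_lt_at.
Qed.

(** Raising one digit and replacing what follows: the way in which an expansion
    with a tail of value above 1 yields another expansion of the same number. *)
Definition increment M n (c e : digits M) : digits M := fun i =>
  if (i < n)%N then c i else if i == n then inord (c n).+1 else e (i - n.+1)%N.

Lemma increment_lt_at M n (c e : digits M) :
  (c n < M)%N -> lt_at n c (increment n c e).
Proof.
move=> cn; rewrite /increment; split=> [i ->//|].
by rewrite ltnn eqxx inordK.
Qed.

Lemma shift_increment M n (c e : digits M) :
  shift n.+1 (increment n c e) = e.
Proof.
apply/funext => i; rewrite /Defs.shift /increment.
by rewrite ltnNge ltnW ?leq_addr// gtn_eqF ?leq_addr//= addKn.
Qed.

Lemma increment_value (R : realType) M (q : R) n (c e : digits M) : 1 < q ->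
  (c n < M)%N -> expansion_value q (increment n c e) =
  expansion_value q c +
    q ^- n.+1 * (1 + expansion_value q e - expansion_value q (shift n.+1 c)).
Proof.
move=> q1 cn; have q0 : q != 0 by rewrite gt_eqF// (lt_trans _ q1).
have [agr _] := increment_lt_at e cn.
apply/eqP; rewrite addrC -subr_eq (expansion_value_agree q1 (agree_sym agr)).
rewrite (expansion_value_rec (shift n _))//.
rewrite (expansion_value_rec (shift n c))// !shiftS shift_increment.
rewrite [shift n c _]/Defs.shift [shift n _ _]/Defs.shift addn0.
rewrite {1}/increment ltnn eqxx inordK// -natr1 exprS; apply/eqP.
by field; rewrite q0 expf_neq0.
Qed.

Lemma expansion_exists (R : realType) M (q x : R) :
  1 < q -> q <= M.+1%:R -> 0 <= x -> x <= M%:R / (q - 1) ->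
  exists c : digits M, expansion_value q c = x.
Proof.
move=> q1 qM; rewrite le_eqVlt => /predU1P[<- _|x0 xM].
  by exists (fun=> ord0); exact: expansion_value0.
by have [c []] := quasi_greedy_exists q1 qM x0 xM; exists c.
Qed.

(** Such a [c] is the greedy expansion of its value. *)
Lemma tails_lt_greedy (R : realType) M (q : R) k (c d : digits M) : 1 < q ->
  tails_lt q c -> lt_at k c d -> expansion_value q c < expansion_value q d.
Proof.
move=> q1 c_lt cd.
apply: (le_lt_trans (first_difference q1 cd)).
rewrite gtrDl pmulr_rlt0 ?invr_gt0 ?exprn_gt0 ?(lt_trans _ q1)//.
have := expansion_value_ge0 (shift k.+1 d) q1.
have := c_lt k (leq_trans cd.2 (leq_ord (d k))); lra.
Qed.

Lemma big_base_value (R : realType) M (q : R) (c : digits M) :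
  M.+1%:R < q -> 1 < q -> expansion_value q c < 1.
Proof.
move=> Mq q1; apply: (le_lt_trans (expansion_value_le c q1)).
by rewrite ltr_pdivrMr ?subr_gt0// mul1r ltrBrDr natr1.
Qed.

(** Were a tail after a digit below [M] worth at least 1, that digit could be
    raised and the tail replaced by an expansion of the rest. Above [M + 1],
    where expansions may be missing, all values are below 1 anyway. *)
Lemma univoque_tails_lt (R : realType) M (q : R) (c : digits M) : 1 < q ->
  univoque_seqs M q c -> tails_lt q c.
Proof.
move=> q1 [d [_ uniq_d]] n cn.
have [qM|Mq] := leP q M.+1%:R; last exact: big_base_value.
rewrite ltNge; apply/negP => ge1.
have [||e eE] :=
  @expansion_exists R M q (expansion_value q (shift n.+1 c) - 1) q1 qM.
- by rewrite subr_ge0.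
- by rewrite lerBlDr ler_wpDr ?expansion_value_le.
have [_ ] := increment_lt_at e cn.
suff <- : c = increment n c e by rewrite ltnn.
transitivity d; first by rewrite (uniq_d c).
by apply: uniq_d; rewrite increment_value// eE; ring.
Qed.

Lemma univoque_reflection (R : realType) M (q : R) (c : digits M) : 1 < q ->
  univoque_seqs M q c -> univoque_seqs M q (reflection c).
Proof.
move=> q1 [d [dc uniq_d]]; exists (reflection d); split.
  by rewrite !expansion_value_reflection// dc.
move=> e ec; rewrite (uniq_d (reflection e)) ?reflectionK//.
by rewrite expansion_value_reflection// ec expansion_value_reflection// subKr.
Qed.

Lemma univoque_seqsP (R : realType) M (q : R) (c : digits M) : 1 < q ->
  univoque_seqs M q c <-> tails_lt q c /\ tails_lt q (reflection c).
Proof.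
move=> q1; split=> [cU|[c_lt rc_lt]].
  split; first exact: univoque_tails_lt.
  by apply: univoque_tails_lt => //; exact: univoque_reflection.
exists c; split=> // d dc; case: (lex_trichotomy c d) => // -[k].
  by move=> /(tails_lt_greedy q1 c_lt); rewrite dc ltxx.
move=> /lt_at_reflection/(tails_lt_greedy q1 rc_lt).
by rewrite !expansion_value_reflection// dc ltxx.
Qed.

Definition tails_lex_le M (a c : digits M) :=
  forall n, (c n < M)%N -> lex_le (shift n.+1 c) a.

(** A tail of value above 1 has, after its first difference with [a], a tail
    that exceeds 1 at least [q] times as much. As values are bounded, the excess
    is 0. *)
Lemma tails_lex_value (R : realType) M (q : R) (a c : digits M) : 1 < q ->
  expansion_value q a <= 1 -> tails_lex_le a c -> tails_le q c.
Proof.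
move=> q1 a1 c_lex; have q0 : 0 < q by apply: lt_trans q1.
set B := (M%:R / (q - 1) : R).
have B0 : 0 <= B.
  by apply: le_trans (expansion_value_le a q1); exact: expansion_value_ge0.
have close N : forall n, (c n < M)%N ->
    expansion_value q (shift n.+1 c) <= 1 + B * q ^- N.
  elim: N => [|N IH] n cn.
    by rewrite expr0 invr1 mulr1 ler_wpDl ?expansion_value_le.
  have BN : 0 <= B * q ^- N.+1.
    by rewrite mulr_ge0// invr_ge0 exprn_ge0// ltW.
  have [->|[k ck]] := c_lex n cn; first by apply: (le_trans a1); rewrite lerDl.
  apply: (le_trans (first_difference q1 ck)).
  have ckM : (c (n.+1 + k) < M)%N by apply: leq_trans ck.2 (leq_ord _).
  have := IH _ ckM; rewrite -addnS -shift_shift => le_N.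
  have := expansion_value_ge0 (shift k.+1 a) q1.
  move: le_N; set u := expansion_value q _; set v := expansion_value q _.
  move=> le_N v0; apply: lerD => //.
  have k0 : 0 <= q ^- k.+1 by rewrite invr_ge0 exprn_ge0// ltW.
  apply: (@le_trans _ _ (q ^- k.+1 * (B * q ^- N))).
    by rewrite ler_wpM2l//; lra.
  rewrite mulrC -mulrA ler_wpM2l// -invfM -exprD lef_pV2 ?posrE ?exprn_gt0//.
  by rewrite ler_weXn2l ?(ltW q1)// addnS ltnS leq_addr.
move=> n cn; apply/ler_addgt0Pr => e e0.
have [N Ne] := exprV_small B q1 e0.
by apply: (le_trans (close N n cn)); rewrite lerD2l ltW.
Qed.

Lemma infinite_shift M n (c : digits M) :
  seq_infinite c -> seq_infinite (shift n c).
Proof.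
move=> [->|inf]; first by left.
right=> k; have [m nkm cm] := inf (n + k)%N.
by exists (m - n)%N; rewrite ?/Defs.shift ?subnKC//; lia.
Qed.

(** Otherwise [c] would end with digits [M] after a smaller digit, and that tail
    has value [M / (q - 1) > 1]. *)
Lemma infinite_reflection (R : realType) M (q : R) (c : digits M) : 1 < q ->
  q < M.+1%:R -> tails_le q c -> seq_infinite (reflection c).
Proof.
move=> q1 qM c_le.
have [[k /eqP k0]|pos] :=
    pselect (exists k, expansion_value q (shift k (reflection c)) = 0); last first.
  apply: (tail_gt0_infinite q1) => n; rewrite lt_neqAle expansion_value_ge0//.
  by rewrite andbT eq_sym; apply/eqP => n0; apply: pos; exists n.
have ex_k : exists k, expansion_value q (shift k (reflection c)) == 0 by exists k.
case: (ex_minnP ex_k) => -[|j] /eqP j0 min_j.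
  by left; exact: expansion_value_eq0 j0.
have : (c j < M)%N.
  rewrite -[c]reflectionK reflection_lt lt0n; apply/negP => cj0.
  suff /min_j : expansion_value q (shift j (reflection c)) == 0 by rewrite ltnn.
  by rewrite expansion_value_rec// shiftS j0 /Defs.shift addn0 (eqP cj0) addr0 mul0r.
move=> /c_le; rewrite -[c]reflectionK shift_reflection expansion_value_reflection//.
rewrite j0 subr0 leNgt => /negP[].
by rewrite ltr_pdivlMr ?subr_gt0// mul1r ltrBlDr natr1.
Qed.

Lemma V_seqs_lexP (R : realType) M (q : R) (c : digits M) :
  V_seqs M q c <-> [/\ seq_infinite c, tails_lex_le (alpha M q) c &
    tails_lex_le (alpha M q) (reflection c)].
Proof.
split=> [[c_inf cV]|[c_inf c_lex rc_lex]].
  split=> // n; first by move=> cn; exact: (cV n).1.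
  rewrite reflection_lt => /((cV n).2)/lex_le_reflection.
  by rewrite reflectionK.
split=> // n; split=> [cn|cn]; first exact: c_lex.
by rewrite -[shift _ _]reflectionK; apply: lex_le_reflection; apply: rc_lex;
  rewrite reflection_lt.
Qed.

(** From [M + 1] on both conditions on tails are vacuous, so that a single criterion
    covers all bases. *)
Lemma V_seqsP (R : realType) M (q : R) (c : digits M) : 1 < q ->
  V_seqs M q c <-> [/\ seq_infinite c, tails_le q c & tails_le q (reflection c)].
Proof.
move=> q1; rewrite V_seqs_lexP; have [qM|Mq] := ltP q M.+1%:R.
  have [a1 a_le _] := alphaP q1 (ltW qM).
  split=> -[c_inf c_le rc_le]; split=> //.
  - by apply: tails_lex_value c_le => //; rewrite a1.
  - by apply: tails_lex_value rc_le => //; rewrite a1.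
  - move=> n cn; apply: (value_le_lex_le q1 a_le); last by rewrite a1 c_le.
    exact: infinite_shift.
  - move=> n cn; apply: (value_le_lex_le q1 a_le); last by rewrite a1 rc_le.
    by apply: infinite_shift; exact: infinite_reflection qM c_le.
have trivV (d : digits M) : tails_le q d.
  move=> n _; apply: (le_trans (expansion_value_le _ q1)).
  by rewrite ler_pdivrMr ?subr_gt0// mul1r lerBrDr natr1.
have trivL (d : digits M) : tails_lex_le (alpha M q) d.
  move=> n _; rewrite alpha_full//; apply: lex_leP => k [_].
  by rewrite ltnNge leq_ord.
by split=> -[].
Qed.

Lemma tails_le_lt (R : realType) M (p q : R) (c : digits M) : 1 < p -> p < q ->
  tails_le p c -> tails_lt q c.
Proof.
move=> p1 pq c_le n cn; have := c_le n cn.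
have := expansion_value_ge0 (shift n.+1 c) p1.
rewrite le_eqVlt => /predU1P[v0 _|v0]; last first.
  by move=> v1; exact: lt_le_trans (expansion_value_decr p1 pq v0) v1.
by apply: le_lt_trans (expansion_value_nincr _ p1 (ltW pq)) _; rewrite -v0.
Qed.

Lemma tails_ltW (R : realType) M (q : R) (c : digits M) :
  tails_lt q c -> tails_le q c.
Proof. by move=> c_lt n /c_lt/ltW. Qed.

(** The interleaving of the two families, from the strict monotonicity of values
    in the base. *)
Lemma V_seqs_sub_univoque (R : realType) M (p q : R) : 1 < p -> p < q ->
  V_seqs M p `<=` univoque_seqs M q.
Proof.
move=> p1 pq c /(V_seqsP _ p1)[_ c_le rc_le].
apply/univoque_seqsP; first exact: lt_trans pq.
by split; exact: tails_le_lt pq _.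
Qed.

Lemma univoque_sub_V_seqs (R : realType) M (q : R) : 1 < q -> q < M.+1%:R ->
  univoque_seqs M q `<=` V_seqs M q.
Proof.
move=> q1 qM c /(univoque_seqsP _ q1)[/tails_ltW c_le /tails_ltW rc_le].
apply/V_seqsP => //; split=> //; rewrite -(reflectionK c).
exact: infinite_reflection rc_le.
Qed.

Lemma univoque_seqs_mono (R : realType) M (p q : R) : 1 < p -> p <= q ->
  univoque_seqs M p `<=` univoque_seqs M q.
Proof.
rewrite le_eqVlt => p1 /predU1P[->//|pq] c.
move=> /(univoque_seqsP _ p1)[/tails_ltW c_le /tails_ltW rc_le].
apply/univoque_seqsP; first exact: lt_trans pq.
by split; exact: tails_le_lt pq _.
Qed.

Lemma V_seqs_mono (R : realType) M (p q : R) : 1 < p -> p <= q ->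
  V_seqs M p `<=` V_seqs M q.
Proof.
rewrite le_eqVlt => p1 /predU1P[->//|pq] c.
move=> /(V_seqsP _ p1)[c_inf c_le rc_le].
apply/V_seqsP; first exact: lt_trans pq.
by split=> //; apply: tails_ltW; exact: tails_le_lt pq _.
Qed.

(** * Sequences that stay away from the expansion of 1 *)

Definition lt_in M m (x y : digits M) := exists2 k, (k < m)%N & lt_at k x y.

Definition tails_lt_in M m (a c : digits M) :=
  forall n, (c n < M)%N -> lt_in m (shift n.+1 c) a.

Lemma lt_in_lex_le M m (x y : digits M) : lt_in m x y -> lex_le x y.
Proof. by move=> [k _ xy]; right; exists k. Qed.

Lemma lex_le_lt_in M m (x y : digits M) :
  lex_le x y -> ~ agree m x y -> lt_in m x y.
Proof.
move=> [->|[k xy]] nagr; first by case: nagr.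
have [km|mk] := ltnP k m; first by exists k.
by case: nagr; exact: agree_le mk xy.1.
Qed.

Lemma tails_le_shift (R : realType) M (q : R) n (c : digits M) :
  tails_le q c -> tails_le q (shift n c).
Proof. by move=> c_le k /c_le; rewrite shift_shift addnS. Qed.

Lemma tails_lt_shift (R : realType) M (q : R) n (c : digits M) :
  tails_lt q c -> tails_lt q (shift n c).
Proof. by move=> c_lt k /c_lt; rewrite shift_shift addnS. Qed.

Lemma lt_in_value (R : realType) M (q : R) m (x a : digits M) : 1 < q ->
  tails_le q x -> lt_in m x a ->
  expansion_value q x <=
    expansion_value q a - q ^- m * expansion_value q (shift m a).
Proof.
move=> q1 x_le [k km xa]; have q0 : 0 < q by apply: lt_trans q1.
have x1 := x_le k (leq_trans xa.2 (leq_ord _)).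
apply: (le_trans (first_difference_le q1 xa x1)).
rewrite lerD2l lerN2 -(subnKC km) -shift_shift exprD invfM -mulrA.
by rewrite ler_wpM2l ?invr_ge0 ?exprn_ge0 ?(ltW q0)// expansion_value_ge_tail.
Qed.

(** Tails that fall below [a] within [m] digits stay below 1 by a margin that
    does not depend on the tail; the margin leaves room for a slightly smaller
    base. *)
Lemma tails_lt_in_univoque (R : realType) M (q : R) m (a c : digits M) : 1 < q ->
  expansion_value q a = 1 -> 0 < expansion_value q (shift m a) ->
  tails_lt_in m a c -> tails_lt_in m a (reflection c) ->
  exists p, [/\ 1 < p, p < q & univoque_seqs M p c].
Proof.
move=> q1 a1 am c_lt rc_lt; have q0 : 0 < q by apply: lt_trans q1.
set e := q ^- m * expansion_value q (shift m a).
have e0 : 0 < e by rewrite mulr_gt0// invr_gt0 exprn_gt0.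
have gap d : tails_lt_in m a d ->
    forall n, (d n < M)%N -> expansion_value q (shift n.+1 d) <= 1 - e.
  move=> d_lt n dn; rewrite -{1}a1; apply: lt_in_value => //; last exact: d_lt.
  apply: tails_le_shift; apply: (@tails_lex_value _ _ _ a) => //.
    by rewrite a1.
  by move=> k /d_lt/lt_in_lex_le.
have : \forall p \near q^'-, p < q /\ (1 < p /\ forall c : digits M,
    `|expansion_value p c - expansion_value q c| < e).
  near=> p; split; first by near: p; exact: nbhs_left_lt.
  by near: p; apply: cvg_within; exact: expansion_value_near.
move=> /filter_ex[p [pq [p1 pe]]]; exists p; split=> //.
have strict d : tails_lt_in m a d -> tails_lt p d.
  move=> d_lt n dn; have := gap d d_lt n dn.
  by have := pe (shift n.+1 d); rewrite ltr_norml => /andP[]; lra.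
by apply/univoque_seqsP => //; split; exact: strict.
Unshelve. all: by end_near. Qed.

Lemma value_lt_lt_at (R : realType) M (q : R) (d a : digits M) : 1 < q ->
  tails_le q a -> expansion_value q d < expansion_value q a ->
  exists k, lt_at k d a.
Proof.
move=> q1 a_le da; case: (lex_trichotomy d a) => // [dE|[k ad]].
  by rewrite dE ltxx in da.
have := first_difference_le q1 ad (a_le k (leq_trans ad.2 (leq_ord _))).
have : 0 <= q ^- k.+1 * expansion_value q (shift k.+1 d).
  by rewrite mulr_ge0 ?expansion_value_ge0// invr_ge0 exprn_ge0// ltW// (lt_trans _ q1).
lra.
Qed.

(** If a reflected tail of [a] is worth more than 1, so is that of any sequence
    with a sufficiently long common prefix; the lower condition excludes this
    prefix. *)
Lemma not_V_tails_lt_in (R : realType) M (q : R) (a : digits M) : 1 < q ->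
  ~ tails_le q (reflection a) ->
  exists m, forall c, tails_lex_le a c -> tails_le q (reflection c) ->
    tails_lt_in m a c.
Proof.
move=> q1 /existsNP[k]; rewrite reflection_lt => /not_implyP[ak /negP].
rewrite -ltNge -subr_gt0 => gap.
have [N small] := exprV_small (M%:R / (q - 1)) q1 gap.
exists (k.+1 + N)%N => c c_lex rc_le n cn; apply: lex_le_lt_in (c_lex n cn) _.
move=> agr; have : (reflection c (n.+1 + k) < M)%N.
  rewrite reflection_lt; suff -> : c (n.+1 + k)%N = a k by [].
  by apply: agr; rewrite ltn_addr.
move=> /rc_le; rewrite -addnS -shift_shift !shift_reflection.
have := expansion_value_dist q1 (agree_reflection (agree_shift agr)).
rewrite ler_norml -shift_reflection => /andP[]; lra.
Qed.

Lemma not_agree_lt_in M m (x y : digits M) : ~ agree m x y ->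
  lt_in m x y \/ lt_in m (reflection x) (reflection y).
Proof.
move=> nagr; case: (lex_trichotomy x y) => [xy|[k xy]|[k yx]].
- by case: nagr; rewrite xy.
- by left; apply: lex_le_lt_in => //; right; exists k.
- right; apply: lex_le_lt_in => [|/agree_reflection]; last first.
    by rewrite !reflectionK.
  by right; exists k; exact: lt_at_reflection.
Qed.

Section PeriodicCase.
Variables (R : realType) (M : nat) (q : R) (a : digits M) (k : nat).
Hypotheses (q1 : 1 < q) (a1 : expansion_value q a = 1) (a_le : tails_le q a).
Hypotheses (ak : (0 < a k)%N) (a_per : shift k.+1 (reflection a) = a).

(** After the common prefix, [c] continues above the reflection of [a], with
    which [a] itself continues. *)
Lemma reflected_prefix_value (c : digits M) :
  tails_lt q (reflection c) -> agree k.+1 c a -> 1 < expansion_value q c.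
Proof.
move=> c_lt agr; rewrite -subr_gt0 -a1 (expansion_value_agree q1 agr).
rewrite mulr_gt0 ?invr_gt0 ?exprn_gt0 ?(lt_trans _ q1)//.
have := c_lt k; rewrite reflection_lt agr// shift_reflection.
move=> /(_ ak).
have := congr1 (expansion_value q) a_per; rewrite a1 shift_reflection.
rewrite !expansion_value_reflection//; lra.
Qed.

Lemma univoque_avoids_prefix (c : digits M) :
  univoque_seqs M q c -> tails_lt_in k.+1 a c.
Proof.
move=> /(univoque_seqsP _ q1)[c_lt rc_lt] n cn; have c1 := c_lt n cn.
apply: lex_le_lt_in.
  right; apply: (value_lt_lt_at q1) => //; by rewrite a1.
move=> /(reflected_prefix_value _); rewrite -shift_reflection => H.
have := H (tails_lt_shift rc_lt); by rewrite ltNge (ltW c1).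
Qed.

(** The reflected tail of [c] after [k.+1] digits would start with the first
    [k.+1] digits of [a], hence be worth more than 1, although it follows a
    nonzero digit. *)
Lemma univoque_not_agree (c : digits M) : univoque_seqs M q c ->
  ~ agree (k.+1 + k.+1) c a.
Proof.
move=> /(univoque_seqsP _ q1)[c_lt rc_lt] agr.
have : 1 < expansion_value q (shift k.+1 (reflection c)).
  apply: reflected_prefix_value.
    by rewrite -shift_reflection reflectionK; exact: tails_lt_shift.
  rewrite -[X in agree _ _ X]a_per; apply: agree_shift.
  exact: agree_reflection.
rewrite ltNge => /negP; apply; apply: ltW; apply: rc_lt.
by rewrite reflection_lt agr// ltn_addr.
Qed.

Lemma shift_double_period : shift (k.+1 + k.+1) a = a.
Proof.
have half : shift k.+1 a = reflection a.
  by rewrite -{1}(reflectionK a) shift_reflection a_per.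
by rewrite -shift_shift half a_per.
Qed.
Hypothesis a_pos : forall n, 0 < expansion_value q (shift n a).

Lemma reflection_tail_pos n : 0 < expansion_value q (shift n (reflection a)).
Proof.
apply: lt_le_trans (expansion_value_ge_tail k.+1 _ q1).
rewrite shift_shift addnC -shift_shift a_per.
by rewrite mulr_gt0// invr_gt0 exprn_gt0// (lt_trans _ q1).
Qed.

Let m := (k.+1 + k.+1)%N.

Lemma periodic_value_gap : exists2 e, 0 < e &
  forall c : digits M, univoque_seqs M q c -> e <= `|expansion_value q c - 1|.
Proof.
have pos (x : R) : 0 < x -> 0 < q ^- m * x.
  by move=> x0; rewrite mulr_gt0// invr_gt0 exprn_gt0// (lt_trans _ q1).
have := pos _ (a_pos m); have := pos _ (reflection_tail_pos m).
set e1 := q ^- m * _; set e2 := q ^- m * _ => e10 e20.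
exists (Num.min e1 e2); first by rewrite lt_min e10.
move=> c cU; rewrite ge_min.
have /(univoque_seqsP _ q1)[/tails_ltW c_le /tails_ltW rc_le] := cU.
have := not_agree_lt_in (univoque_not_agree cU).
move=> [/(lt_in_value q1 c_le)|/(lt_in_value q1 rc_le)].
  rewrite a1 -/e2 => ?; apply/orP; right; rewrite distrC ger0_norm; lra.
rewrite -/e1 !expansion_value_reflection// a1 => ?; apply/orP; left.
by rewrite ger0_norm; lra.
Qed.

(** Let [c] be the unique expansion of 1 in a base [p] near [q]. For [p <= q],
    [c] is also univoque in base [q], and the gap at [q] applies. For [p > q],
    either [c] differs from [a] early and cannot have the value 1, or it starts
    with a full period of [a]: as [a] is worth less than 1 in base [p],
    replacing its tail by one of value at most 1 does not bring the value up to
    1. *)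
Lemma periodic_not_closure : ~ closure (univoque_bases M) q.
Proof.
have [e e0 gap] := periodic_value_gap.
have e2_gt0 : 0 < q ^- m * expansion_value q (shift m (reflection a)).
  by rewrite mulr_gt0 ?reflection_tail_pos// invr_gt0 exprn_gt0// (lt_trans _ q1).
pose f (p : R) := expansion_value p a +
  p ^- m * expansion_value p (shift m (reflection a)).
have f_cont : f p @[p --> q] --> f q.
  apply: cvgD; first exact: expansion_value_continuous.
  apply: cvgM; last exact: expansion_value_continuous.
  apply: cvgV; first by rewrite expf_neq0// gt_eqF// (lt_trans _ q1).
  exact: exprn_continuous.
have f_gt : \forall p \near q, 1 < f p.
  apply: (cvgr_gt (f q)) f_cont _ _; rewrite /f a1; lra.
have near_q : nbhs q [set p | [/\ 1 < p, 1 < f p &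
    forall c : digits M, `|expansion_value p c - expansion_value q c| < e]].
  have := @expansion_value_near R M q e q1 e0.
  by apply: filterS2 f_gt => p ? [].
move=> /(_ _ near_q)[p [[_ [c [c1 c_uniq]]] [p1 fp pe]]].
have cU : univoque_seqs M p c by exists c; split=> // d; rewrite c1; exact: c_uniq.
have [pq|qp] := leP p q.
  have := gap c (univoque_seqs_mono p1 pq cU).
  by rewrite leNgt distrC -{1}c1 pe.
have /(univoque_seqsP _ p1)[c_lt rc_lt] := cU.
have a_lt1 : expansion_value p a < 1.
  by rewrite -a1; apply: expansion_value_decr => //; rewrite a1.
have [agr|nagr] := pselect (agree m c a).
  have := expansion_value_agree p1 agr; rewrite c1 shift_double_period.
  have : expansion_value p (shift m c) <= 1.
    rewrite /m addnS; apply: ltW; apply: c_lt.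
    rewrite agr; last by rewrite /m addnS.
    rewrite -[a]reflectionK reflection_lt.
    by have := congr1 (fun s => s k) a_per; rewrite {1}/Defs.shift => ->.
  have pm : p ^- m < 1.
    by rewrite invf_lt1 ?exprn_gt0 ?(lt_trans _ p1)// exprn_egt1.
  move: (expansion_value p (shift m c)) => u u1 E.
  have : p ^- m * (u - expansion_value p a) <= p ^- m * (1 - expansion_value p a).
    by rewrite ler_wpM2l ?lerD2r// invr_ge0 exprn_ge0// ltW// (lt_trans _ p1).
  rewrite -E leNgt => /negP; apply.
  by rewrite gtr_pMl// subr_gt0.
case: (not_agree_lt_in nagr).
  move=> /(lt_in_value p1 (tails_ltW c_lt)); rewrite c1 => H.
  have : 0 <= p ^- m * expansion_value p (shift m a).
    by rewrite mulr_ge0 ?expansion_value_ge0// invr_ge0 exprn_ge0// ltW// (lt_trans _ p1).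
  lra.
move=> /(lt_in_value p1 (tails_ltW rc_lt)).
rewrite (expansion_value_reflection c)// (expansion_value_reflection a)// c1.
move: fp; rewrite /f; lra.
Qed.
End PeriodicCase.

(** [a] is lexicographically the largest infinite expansion of 1, and its
    reflection is the largest infinite expansion of its own value, so a doubly
    infinite expansion of 1 is squeezed between [a] and [a]. *)
Lemma V_bases_of_reflection (R : realType) M (q : R) (a : digits M) : 1 < q ->
  expansion_value q a = 1 -> tails_le q a -> tails_le q (reflection a) ->
  doubly_infinite a -> V_bases M q.
Proof.
move=> q1 a1 a_le ra_le [a_inf ra_inf]; split=> //; exists a; split=> //.
move=> d [[d_inf rd_inf] d1].
apply: lex_le_anti; last first.
  by apply: value_le_lex_le q1 a_le d_inf _; rewrite a1 d1.
rewrite -[a]reflectionK -[d]reflectionK; apply: lex_le_reflection.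
apply: (value_le_lex_le q1 ra_le rd_inf).
by rewrite !expansion_value_reflection// a1 d1.
Qed.

(** Dropping a leading digit [M] does not increase the value; this extends
    conditions on the tails after digits below [M] to all tails. *)
Lemma full_digit_tail (R : realType) M (q : R) n (c : digits M) : 1 < q ->
  (M <= c n)%N -> expansion_value q (shift n.+1 c) <= expansion_value q (shift n c).
Proof.
move=> q1 Mc; have cn : (c n : nat) = M by apply/eqP; rewrite eqn_leq Mc leq_ord.
rewrite (expansion_value_rec (shift n c))// shiftS.
rewrite {2}/Defs.shift addn0 cn ler_pdivlMr ?(lt_trans _ q1)//.
have := expansion_value_le (shift n.+1 c) q1.
by rewrite ler_pdivlMr ?subr_gt0//; lra.
Qed.

Lemma tails_le_all (R : realType) M (q : R) (c : digits M) : 1 < q ->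
  tails_le q c -> expansion_value q c <= 1 ->
  forall n, expansion_value q (shift n c) <= 1.
Proof.
move=> q1 c_le c1; elim=> [//|n IH]; have [/c_le//|Mc] := ltnP (c n) M.
by apply: le_trans IH; exact: full_digit_tail.
Qed.

Lemma tails_lt_all (R : realType) M (q : R) (c : digits M) : 1 < q ->
  tails_lt q c -> expansion_value q c < 1 ->
  forall n, expansion_value q (shift n c) < 1.
Proof.
move=> q1 c_lt c1; elim=> [//|n IH]; have [/c_lt//|Mc] := ltnP (c n) M.
by apply: le_lt_trans IH; exact: full_digit_tail.
Qed.

(** Were a reflected tail worth more than 1, incrementing the digit before it
    would give a second doubly infinite expansion of 1. *)
Lemma V_bases_tails_le (R : realType) M (q : R) : 1 < q -> q <= M.+1%:R ->
  V_bases M q -> tails_le q (reflection (alpha M q)).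
Proof.
move=> q1; rewrite le_eqVlt => /predU1P[qE|qM].
  move=> _ n _; apply: le_trans (expansion_value_le _ q1) _.
  by rewrite ler_pdivrMr ?subr_gt0// mul1r lerBrDr natr1 qE.
have [a1 a_le a_pos] := alphaP q1 (ltW qM); set a := alpha M q.
have a_inf : seq_infinite a by exact: tail_gt0_infinite a_pos.
have ra_inf : seq_infinite (reflection a) by exact: infinite_reflection a_le.
move=> [_ [d [_ uniq_d]]] n ran; rewrite leNgt; apply/negP => gt1.
have [||e [eE e_le e_pos]] := @quasi_greedy_exists R M q
  (expansion_value q (shift n.+1 (reflection a)) - 1) q1 (ltW qM).
- by rewrite subr_gt0.
- by rewrite lerBlDr ler_wpDr ?expansion_value_le.
have [_ neq] := increment_lt_at e ran.
suff E : increment n (reflection a) e = reflection a by rewrite E ltnn in neq.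
rewrite -[LHS]reflectionK; congr reflection.
transitivity d; last by apply: uniq_d; split.
apply/esym/uniq_d; split; last first.
  rewrite expansion_value_reflection// increment_value// eE.
  by rewrite expansion_value_reflection// a1; ring.
have inf_of_shift (x : digits M) N :
    (forall k, exists2 j, (k <= j)%N & shift N x j != ord0) -> seq_infinite x.
  move=> H; right=> k; have [j kj xj] := H k.
  by exists (N + j)%N => //; apply: leq_trans kj _; rewrite leq_addl.
split; last first.
  rewrite reflectionK.
  have [e0|] := tail_gt0_infinite q1 e_pos.
    by have := e_pos 0%N; rewrite e0 expansion_value0 ?ltxx.
  by move=> H; apply: (inf_of_shift _ n.+1); rewrite shift_increment.
have [re0|] := infinite_reflection q1 qM e_le; last first.
  move=> H; apply: (inf_of_shift _ n.+1).
  by rewrite shift_reflection shift_increment.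
have : expansion_value q e = M%:R / (q - 1).
  have := expansion_value_reflection (reflection e) q1.
  by rewrite reflectionK re0 expansion_value0// subr0.
have := expansion_value_le (shift n.+1 (reflection a)) q1.
rewrite eE; lra.
Qed.

(** * Good prefixes *)

Definition cat_digits M n (c e : digits M) : digits M :=
  fun i => if (i < n)%N then c i else e (i - n)%N.

Lemma agree_cat M n (c e : digits M) : agree n (cat_digits n c e) c.
Proof. by move=> i i_n; rewrite /cat_digits i_n. Qed.

Lemma shift_cat M n k (c e : digits M) : (n <= k)%N ->
  shift k (cat_digits n c e) = shift (k - n) e.
Proof.
move=> nk; apply/funext => i; rewrite /Defs.shift /cat_digits.
by rewrite ltnNge (leq_trans nk) ?leq_addr//= addnBAC.
Qed.

Lemma reflection_cat M n (c e : digits M) :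
  reflection (cat_digits n c e) = cat_digits n (reflection c) (reflection e).
Proof. by apply/funext => i; rewrite /reflection /cat_digits; case: ifP. Qed.

Lemma lt_in_agreel M m (x y a : digits M) :
  agree m x y -> lt_in m x a -> lt_in m y a.
Proof.
move=> xy [k km [xa ltk]]; exists k => //; split.
  by apply: agree_trans xa; apply: agree_sym; apply: agree_le xy; exact: ltnW.
by rewrite -xy.
Qed.

Lemma lt_in_agreer M m (x a b : digits M) :
  agree m a b -> lt_in m x a -> lt_in m x b.
Proof.
move=> ab [k km [xa ltk]]; exists k => //; split.
  by apply: agree_trans xa _; apply: agree_le ab; exact: ltnW.
by rewrite -ab.
Qed.

Lemma lt_in_le M m n (x a : digits M) : (m <= n)%N -> lt_in m x a -> lt_in n x a.
Proof. by move=> mn [k km xa]; exists k => //; exact: leq_trans mn. Qed.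

Lemma lt_in_prefix M m n (x a : digits M) k :
  agree m x a -> lt_in n (shift m x) (shift m a) -> (m + n <= k)%N -> lt_in k x a.
Proof.
move=> xa [j jn [xaj ltj]] mnk; exists (m + j)%N.
  by apply: leq_trans mnk; rewrite ltn_add2l.
split=> // i ij; have [im|mi] := ltnP i m; first exact: xa.
have := xaj (i - m)%N; rewrite /Defs.shift subnKC//; apply.
by rewrite ltn_subLR.
Qed.

Lemma lex_le_digit M n (x a : digits M) :
  lex_le x a -> agree n x a -> (x n <= a n)%N.
Proof.
move=> xa agr; rewrite leqNgt; apply/negP => lta.
apply: (lex_le_lt_at (k := n) xa); split=> //; exact: agree_sym.
Qed.

(** The strict inequalities are visible inside the prefix of length [m], so they
    survive when the prefix is continued in another way. *)
Definition good_prefix M m (a : digits M) :=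
  forall k, (k < m)%N -> lt_in (m - k) (shift k (reflection a)) a.

(** Let [l k] be the length of the longest common prefix of [a] and its
    reflected tail at [k]. The length [m] is good when no window from [k < m] to
    [k + l k] reaches [m]. Windows are nested: one that starts inside another,
    at distance [s], and ends outside it would make the tail of [a] at [s]
    larger than [a]. So just after the farthest end of the windows that start
    before [m0], no window is open. *)
Lemma good_prefixes M (a : digits M) :
  (forall k, lex_le (shift k a) a) ->
  (forall k, exists l, lt_at l (shift k (reflection a)) a) ->
  forall m0, exists2 m, (m0 <= m)%N & good_prefix m a.
Proof.
move=> a_le /choice[l lP] m0.
have [/forallP small|/forallPn[k0 k0_max]] :=
    boolP [forall k : 'I_m0, (k + l k < m0)%N].
  exists m0 => // k km; exists (l k); last exact: lP.
  by have := small (Ordinal km); rewrite /= addnC ltn_subRL addnC.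
pose k1 := [arg max_(k > k0) (k + l k)%N].
have k1_max : forall k : 'I_m0, (k + l k <= k1 + l k1)%N.
  by rewrite /k1; case: arg_maxnP => // i _ H k; exact: H.
have m0k1 : (m0 <= k1 + l k1)%N.
  by apply: leq_trans (k1_max k0); rewrite leqNgt.
exists (k1 + l k1).+1; first exact: leqW.
move=> k km; exists (l k) => //.
rewrite ltn_subRL ltnS.
have [km0|m0k] := ltnP k m0; first exact: (k1_max (Ordinal km0)).
rewrite leqNgt; apply/negP => cov.
have k1k : (k1 < k)%N by apply: leq_trans (ltn_ord k1) m0k.
(* The window at [k] would contain the end of the window at [k1]. *)
pose s := (k - k1)%N; have kE : k = (k1 + s)%N by rewrite /s subnKC// ltnW.
have s_l : (s <= l k1)%N by rewrite -ltnS; move: km; rewrite kE; lia.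
apply: (lex_le_lt_at (k := (l k1 - s)%N) (a_le s)).
have [agr1 lt1] := lP k1; have [agr2 _] := lP k.
have rE i : shift k (reflection a) i = shift k1 (reflection a) (s + i)%N.
  by rewrite /Defs.shift kE addnA.
split=> [i i_l|].
  by rewrite -agr2 ?rE ?agr1 //; move: i_l cov; rewrite kE; lia.
rewrite -agr2; last by move: cov; rewrite kE; lia.
by rewrite rE /Defs.shift subnKC.
Qed.

Section GoodPrefix.
Variables (M m : nat) (a : digits M).
Hypotheses (m_gt0 : (0 < m)%N) (a_le : forall k, lex_le (shift k a) a).
Hypothesis a_good : good_prefix m.+1 a.

Lemma good_last_gt0 : (0 < a m)%N.
Proof.
have [|j] := a_good (k := m); first exact: ltnSn.
rewrite subSn// subnn ltnS leqn0 => /eqP-> [_].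
by rewrite /Defs.shift addn0 -reflection_lt; move/leq_trans; apply; exact: leq_ord.
Qed.

(** Decreasing one digit of the prefix brings all tails below [a]; the periodic
    continuation leaves only [m.+1] tails to compare. *)
Definition lowered : digits M := fun i =>
  if (i %% m.+1 == m)%N then inord (a m).-1 else a (i %% m.+1)%N.

Lemma lowered_agree : agree m lowered a.
Proof.
move=> i im; rewrite /lowered modn_small; last exact: leqW.
by rewrite ltn_eqF.
Qed.

Lemma lowered_last : (lowered m = (a m).-1 :> nat)%N.
Proof.
rewrite /lowered modn_small// eqxx inordK//.
by apply: leq_ltn_trans (leq_pred _) _.
Qed.

Lemma shift_lowered k : shift k lowered = shift (k %% m.+1) lowered.
Proof. by apply/funext => i; rewrite /Defs.shift /lowered modnDml. Qed.

(** A suffix of the prefix is at most the prefix; lowering the last digit makes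
    the inequality strict. *)
Lemma lowered_lt k : lt_in m.+1 (shift k lowered) a.
Proof.
rewrite shift_lowered; have : (k %% m.+1 <= m)%N by rewrite -ltnS ltn_pmod.
move: (k %% m.+1)%N => r rm.
have agr : agree (m - r) (shift r a) (shift r lowered).
  apply: agree_shift; rewrite subnKC//; apply: agree_sym; exact: lowered_agree.
have [agr2|nagr] := pselect (agree (m - r) (shift r a) a).
  exists (m - r)%N; first by rewrite ltnS leq_subr.
  split; first exact: agree_trans (agree_sym agr) agr2.
  have := lex_le_digit (a_le r) agr2.
  rewrite /Defs.shift subnKC// lowered_last.
  by apply: leq_trans; rewrite prednK// good_last_gt0.
apply: lt_in_le (lt_in_agreel agr (lex_le_lt_in (a_le r) nagr)).
by rewrite leqW// leq_subr.
Qed.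

(** The reflected suffixes are strictly smaller than the prefix, but reflection
    raises the last digit, which may restore equality. Then the comparison goes
    on with the next period, where goodness at the complementary length decides. *)
Lemma lowered_reflection_lt k : lt_in m.+1 (shift k (reflection lowered)) a.
Proof.
rewrite shift_reflection shift_lowered -shift_reflection.
have : (k %% m.+1 <= m)%N by rewrite -ltnS ltn_pmod.
move: (k %% m.+1)%N => r rm.
have agr0 : agree m (reflection a) (reflection lowered).
  apply: agree_reflection; apply: agree_sym; exact: lowered_agree.
have agr : agree (m - r) (shift r (reflection a)) (shift r (reflection lowered)).
  by apply: agree_shift; rewrite subnKC.
have [j] := a_good (k := r) rm; rewrite subSn// ltnS leq_eqVlt.
move=> /predU1P[->|jn] [agr1 ltj]; last first.
  have : lt_in (m - r) (shift r (reflection a)) a by exists j.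
  by move=> /(lt_in_agreel agr); apply: lt_in_le; rewrite leqW// leq_subr.
have agr2 := agree_trans (agree_sym agr) agr1.
have last_le : (shift r (reflection lowered) (m - r) <= a (m - r))%N.
  move: ltj; rewrite /Defs.shift subnKC// !reflection_val lowered_last.
  by have := good_last_gt0; have := leq_ord (a m); lia.
move: last_le; rewrite leq_eqVlt => /predU1P[last_eq|last_lt]; last first.
  by exists (m - r)%N => //; rewrite ltnS leq_subr.
have agr3 : agree (m - r).+1 (shift r (reflection lowered)) a.
  move=> i; rewrite ltnS leq_eqVlt => /predU1P[->|]; last exact: agr2.
  exact: val_inj.
case: (posnP r) => [r0|r_gt0].
  (* The first digit would be its own reflection, and the last one larger. *)
  have a0 : reflection a 0%N = a 0%N by rewrite -[RHS]agr1 ?r0// subn0.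
  have le0 : (a m <= a 0%N)%N.
    by have := @lex_le_digit _ 0 _ _ (a_le m); rewrite /Defs.shift addn0; apply.
  move: ltj (congr1 (@nat_of_ord _) a0) (leq_ord (a 0%N)).
  by rewrite r0 subn0 /Defs.shift add0n !reflection_val; lia.
apply: (lt_in_prefix (n := r) agr3); last by rewrite addSn subnK.
have [|j' j'r lt'] := a_good (k := (m - r).+1).
  by rewrite ltnS; lia.
have j'r' : (j' < r)%N by move: j'r; lia.
exists j' => //; rewrite shift_shift addnS subnKC//.
have := lt_at_reflection lt'; rewrite -shift_reflection reflectionK.
move=> [agr4 ltj']; have per i : shift m.+1 (reflection lowered) i = reflection lowered i.
  rewrite shift_reflection shift_lowered modnn.
  by rewrite shift0_digits.
split=> [i ij'|]; first by rewrite per -agr0 ?agr4//; lia.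
by rewrite per -agr0 //; lia.
Qed.

(** A suffix of the prefix may be itself a prefix of [a]; what follows it is
    then the reflected prefix, which is strictly smaller by goodness at the
    complementary length. *)
Lemma cat_lowered_lt k :
  exists l, lt_at l (shift k.+1 (cat_digits m.+1 a (reflection lowered)))
    (cat_digits m.+1 a (reflection lowered)).
Proof.
set t := cat_digits _ _ _; have ta : agree m.+1 a t.
  by apply: agree_sym; exact: agree_cat.
suff [l _ ?] : lt_in m.+1 (shift k.+1 t) t by exists l.
have [mk|km] := leqP m.+1 k.+1.
  rewrite [X in lt_in _ X _]shift_cat//.
  by apply: lt_in_agreer ta _; exact: lowered_reflection_lt.
pose n := (m - k)%N.
have agr : agree n (shift k.+1 a) (shift k.+1 t).
  by apply: agree_shift; apply: agree_le ta; rewrite /n; lia.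
have [agr2|nagr] := pselect (agree n (shift k.+1 a) a); last first.
  have := lt_in_agreel agr (lex_le_lt_in (a_le k.+1) nagr).
  move=> H; apply: lt_in_agreer ta _; apply: lt_in_le H; rewrite /n; lia.
apply: (lt_in_agreer ta).
apply: (lt_in_prefix (m := n) (n := k.+1)); last by rewrite /n; lia.
  exact: agree_trans (agree_sym agr) agr2.
have [|j jk /lt_at_reflection] := a_good (k := n); first by rewrite /n; lia.
rewrite -shift_reflection reflectionK => -[agr3 ltj].
have {}jk : (j < k.+1)%N by move: jk; rewrite /n; lia.
exists j => //; rewrite shift_shift.
have -> : (k.+1 + n = m.+1)%N by rewrite /n; lia.
rewrite shift_cat// subnn shift0_digits.
have agr0 : agree m (reflection lowered) (reflection a).
  by apply: agree_reflection; exact: lowered_agree.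
split=> [i ij|]; first by rewrite agr0 ?agr3//; lia.
by rewrite agr0//; lia.
Qed.

Lemma cat_lowered_reflection_lt k :
  exists l, lt_at l (shift k (reflection (cat_digits m.+1 a (reflection lowered))))
    (cat_digits m.+1 a (reflection lowered)).
Proof.
set t := cat_digits _ _ _; have ta : agree m.+1 a t.
  by apply: agree_sym; exact: agree_cat.
suff [l _ ?] : lt_in m.+1 (shift k (reflection t)) t by exists l.
apply: (lt_in_agreer ta).
have [mk|km] := leqP m.+1 k.
  rewrite /t reflection_cat reflectionK shift_cat//.
  exact: lowered_lt.
apply: (lt_in_le (m := (m.+1 - k)%N)); first by rewrite leq_subr.
apply: lt_in_agreel (a_good km).
apply: agree_shift; rewrite subnKC 1?ltnW//.
exact: agree_reflection.
Qed.

(** Before the cut, no relevant window of [m.+1] digits equals the prefix and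
    none meets the lowered digit; after it, all tails are tails of the periodic
    sequence. *)
Lemma lowered_glue n (c : digits M) : tails_lex_le a c ->
  tails_lex_le a (reflection c) -> agree m.+1 (shift n.+1 c) a ->
  (forall j, (j < n)%N -> (c j < M)%N -> ~ agree m.+1 (shift j.+1 c) a) ->
  (forall j, (j < n)%N -> (0 < c j)%N ->
    ~ agree m.+1 (shift j.+1 (reflection c)) a) ->
  exists d, [/\ agree m c d, tails_lt_in m.+1 a d &
    tails_lt_in m.+1 a (reflection d)].
Proof.
move=> c_le rc_le occ nocc nrocc; pose d := cat_digits n.+1 c lowered.
have agr : agree (n.+1 + m) c d.
  move=> i i_nm; rewrite /d /cat_digits; case: ltnP => // ni.
  rewrite lowered_agree; last by rewrite ltn_subLR.
  rewrite -occ; last by rewrite ltn_subLR// addnS ltnW.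
  by rewrite /Defs.shift subnKC.
have half (c' d' e' : digits M) : tails_lex_le a c' ->
    (forall j, (j < n)%N -> (c' j < M)%N -> ~ agree m.+1 (shift j.+1 c') a) ->
    agree (n.+1 + m) c' d' -> d' = cat_digits n.+1 c' e' ->
    (forall k, lt_in m.+1 (shift k e') a) -> tails_lt_in m.+1 a d'.
  move=> c'_le nocc' agr' dE e'_lt j dj; have [nj|jn] := leqP n j.
    by rewrite dE shift_cat.
  have cj : (c' j < M)%N by rewrite agr'//; lia.
  apply: lt_in_agreel (lex_le_lt_in (c'_le j cj) (nocc' j jn cj)).
  by apply: agree_shift; apply: agree_le agr'; lia.
exists d; split.
- by apply: agree_le agr; rewrite leq_addl.
- by apply: (half c d lowered) => //; exact: lowered_lt.
- apply: (half (reflection c) (reflection d) (reflection lowered)) => //.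
  + by move=> j jn; rewrite reflection_lt; exact: nrocc.
  + exact: agree_reflection.
  + exact: reflection_cat.
  + exact: lowered_reflection_lt.
Qed.

(** Cutting at the first occurrence of the prefix or of its reflection; the
    second case is the first one for the reflected sequence. *)
Lemma lowered_approx (c : digits M) : tails_lex_le a c ->
  tails_lex_le a (reflection c) ->
  exists d, [/\ agree m c d, tails_lt_in m.+1 a d &
    tails_lt_in m.+1 a (reflection d)].
Proof.
move=> c_le rc_le.
pose occ (c : digits M) j := (c j < M)%N /\ agree m.+1 (shift j.+1 c) a.
have [ex|nex] := pselect (exists j, `[< occ c j \/ occ (reflection c) j >]);
    last first.
  exists c; split=> // j cj; apply: lex_le_lt_in; [exact: c_le| |exact: rc_le|];
    move=> agr; apply: nex; exists j; apply/asboolP; [left|right]; by split.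
case: (ex_minnP ex) => n /asboolP occ_n min_n.
have nocc j : (j < n)%N -> ~ (occ c j \/ occ (reflection c) j).
  by move=> jn /asboolP/min_n; rewrite leqNgt jn.
case: occ_n => -[cn agr].
  apply: (lowered_glue (n := n)) => // j jn cj agrj; apply: (nocc j jn).
    by left.
  by right; split; rewrite ?reflection_lt.
have [d [cd d_lt rd_lt]] : exists d, [/\ agree m (reflection c) d,
    tails_lt_in m.+1 a d & tails_lt_in m.+1 a (reflection d)].
  apply: (lowered_glue (n := n)) => //; rewrite ?reflectionK// => j jn cj agrj;
    apply: (nocc j jn).
    by right.
  by left; split=> //; rewrite -(reflectionK c) reflection_lt.
exists (reflection d); split=> //; last by rewrite reflectionK.
by rewrite -(reflectionK c); exact: agree_reflection.
Qed.
End GoodPrefix.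

(** * Strict bases and the closure of the univoque bases *)

(** A reflected tail smaller than [t] has a digit below [M]; hence all tails of
    [t] are positive, which makes the bounds on the tails strict. *)
Lemma strict_lex_univoque (R : realType) M (r : R) (t : digits M) : 1 < r ->
  expansion_value r t = 1 ->
  (forall k, exists l, lt_at l (shift k.+1 t) t) ->
  (forall k, exists l, lt_at l (shift k (reflection t)) t) ->
  univoque_bases M r.
Proof.
move=> r1 t1 t_lt rt_lt.
have t_pos n : 0 < expansion_value r (shift n t).
  have [l [_ ltl]] := rt_lt n.
  apply: (@expansion_value_gt0 _ _ _ l) => //; apply: contraTneq ltl => tl.
  rewrite shift_reflection -leqNgt reflection_val tl subn0; exact: leq_ord.
have tails (c : digits M) : (forall k, exists l, lt_at l (shift k.+1 c) t) ->
    tails_lt r c.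
  move=> c_lt n cn; have [l ltl] := c_lt n.
  have c_le : tails_le r c.
    by apply: (@tails_lex_value _ _ _ t); rewrite ?t1// => k _;
      right; exact: c_lt.
  have := lt_in_value r1 (tails_le_shift (n := n.+1) c_le)
    (ex_intro2 _ _ l (ltnSn l) ltl).
  have : 0 < r ^- l.+1 * expansion_value r (shift l.+1 t).
    by rewrite mulr_gt0// invr_gt0 exprn_gt0// (lt_trans _ r1).
  rewrite t1; lra.
have : univoque_seqs M r t.
  apply/univoque_seqsP => //; split; apply: tails => // k; exact: rt_lt.
move=> [c [ct uniq_c]]; split=> //; exists c; rewrite -t1; split=> //.
Qed.

Lemma alpha_shift_lex_le (R : realType) M (q : R) : 1 < q -> q <= M.+1%:R ->
  forall k, lex_le (shift k (alpha M q)) (alpha M q).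
Proof.
move=> q1 qM k; have [a1 a_le a_pos] := alphaP q1 qM.
apply: (value_le_lex_le q1 a_le).
  by apply: infinite_shift; exact: tail_gt0_infinite a_pos.
by rewrite a1; apply: tails_le_all => //; rewrite a1.
Qed.

(** For the reflection of [a] itself: its first tail is worth less than 1 and
    that of [a] at most 1, so [M / (q - 1) < 2] and the reflection of [a] is
    worth less than 1. *)
Lemma alpha_reflection_lt (R : realType) M (q : R) : 1 < q -> q <= M.+1%:R ->
  tails_lt q (reflection (alpha M q)) ->
  forall k, exists l, lt_at l (shift k (reflection (alpha M q))) (alpha M q).
Proof.
move=> q1 qM ra_lt k; have [a1 a_le a_pos] := alphaP q1 qM.
move: a1 a_le a_pos ra_lt; set a := alpha M q => a1 a_le a_pos ra_lt.
apply: (value_lt_lt_at q1 a_le); rewrite a1; apply: tails_lt_all => //.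
have M_gt0 : (0 < M)%N by rewrite -ltnS -(ltr_nat R); exact: lt_le_trans qM.
have a0 : (0 < a 0%N)%N.
  rewrite lt0n; apply/negP => /eqP a0.
  have := a_le 0%N; rewrite a0 => /(_ M_gt0).
  have := expansion_value_rec a q1.
  rewrite a1 a0 add0r => /(congr1 (fun x => x * q)).
  by rewrite divfK ?mul1r; [lra|rewrite gt_eqF// (lt_trans _ q1)].
have := ra_lt 0%N; rewrite reflection_lt => /(_ a0).
have := tails_le_all q1 a_le; rewrite a1 => /(_ (lexx _) 1%N).
by rewrite shift_reflection !expansion_value_reflection// a1; lra.
Qed.

(** The sequence built from a long good prefix has nearly the value of [a] in
    bases around [q], so its value takes the value 1 at a base close to [q]. *)
Lemma alpha_strict_closure (R : realType) M (q : R) : 1 < q -> q <= M.+1%:R ->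
  tails_lt q (reflection (alpha M q)) -> closure (univoque_bases M) q.
Proof.
move=> q1 qM ra_lt; have [a1 a_le a_pos] := alphaP q1 qM.
have lex := alpha_shift_lex_le q1 qM; have rlex := alpha_reflection_lt q1 qM ra_lt.
move: a1 a_le a_pos lex rlex; set a := alpha M q => a1 a_le a_pos lex rlex.
move=> B /nbhs_ballP[e /= e0 qe].
pose d := Num.min (e / 2) ((q - 1) / 2).
have d0 : 0 < d by rewrite lt_min !divr_gt0// subr_gt0.
have [de dq] : d <= e / 2 /\ d <= (q - 1) / 2.
  by rewrite !ge_min !lexx orbT.
have p1_gt1 : 1 < q - d by lra.
have p2_gt1 : 1 < q + d by lra.
have a_p1 : 0 < expansion_value (q - d) a - 1.
  rewrite subr_gt0 -a1; apply: expansion_value_decr => //; first lra.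
  apply: (@lt_le_trans _ _ (expansion_value q a)); first by rewrite a1.
  by apply: expansion_value_nincr => //; lra.
have a_p2 : 0 < 1 - expansion_value (q + d) a.
  rewrite subr_gt0 -a1; apply: expansion_value_decr => //; first lra.
  by rewrite a1.
have [N1 N1P] := exprV_small (M%:R / (q - d - 1)) p1_gt1 a_p1.
have [N2 N2P] := exprV_small (M%:R / (q + d - 1)) p2_gt1 a_p2.
have [m N_m a_good] := good_prefixes lex rlex (maxn N1 N2).+2.
case: m N_m a_good => // m; rewrite ltnS => N_m a_good.
have m0 : (0 < m)%N by apply: leq_trans N_m.
pose t := cat_digits m.+1 a (reflection (lowered m a)).
have agr N : (N <= maxn N1 N2)%N -> agree N t a.
  by move=> NN; apply: agree_le (agree_cat (n := m.+1) _ _); lia.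
have t_p1 : 1 < expansion_value (q - d) t.
  have := expansion_value_dist p1_gt1 (agr N1 (leq_maxl _ _)).
  by rewrite ler_norml => /andP[]; lra.
have t_p2 : expansion_value (q + d) t < 1.
  have := expansion_value_dist p2_gt1 (agr N2 (leq_maxr _ _)).
  by rewrite ler_norml => /andP[]; lra.
have [|||r] := @IVT R (fun p => expansion_value p t) (q - d) (q + d) 1.
- lra.
- apply: continuous_in_subspaceT => p; rewrite inE/= in_itv/= => /andP[pd _].
  by apply: expansion_value_continuous; exact: lt_le_trans pd.
- by rewrite ge_min le_max (ltW t_p1) (ltW t_p2) orbT.
rewrite in_itv/= => /andP[r1 r2] tr.
exists r; split; last by apply: qe; rewrite /ball/= ltr_norml; lra.
apply: (@strict_lex_univoque _ _ _ t) => //; first lra.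
- by move=> k; exact: cat_lowered_lt.
- by move=> k; exact: cat_lowered_reflection_lt.
Qed.

(** Such an [alpha M q] has period [k.+1 + k.+1], whose second half is the
    reflection of the first. *)
Definition periodic_base (R : realType) M (q : R) :=
  tails_le q (reflection (alpha M q)) /\
  exists2 k, (0 < alpha M q k)%N & shift k.+1 (reflection (alpha M q)) = alpha M q.

(** In the case left over, a reflected tail of value exactly 1 is an infinite
    expansion of 1 satisfying [tails_le], as [alpha M q] is. *)
Lemma alpha_cases (R : realType) M (q : R) : 1 < q -> q <= M.+1%:R ->
  [\/ ~ tails_le q (reflection (alpha M q)), periodic_base M q
   | tails_lt q (reflection (alpha M q))].
Proof.
move=> q1 qM; have [a1 a_le a_pos] := alphaP q1 qM.
rewrite /periodic_base.
move: a1 a_le a_pos; set a := alpha M q => a1 a_le a_pos.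
have [ra_le|] := pselect (tails_le q (reflection a)); last by constructor 1.
have [ra_lt|] := pselect (tails_lt q (reflection a)); first by constructor 3.
move=> /existsNP[k /not_implyP[rak /negP]]; rewrite -leNgt => ge1.
constructor 2; split=> //; exists k; first by rewrite -reflection_lt.
have E1 : expansion_value q (shift k.+1 (reflection a)) = 1.
  by apply/eqP; rewrite eq_le ge1 ra_le.
have ra_inf : seq_infinite (reflection a).
  move: qM; rewrite le_eqVlt => /predU1P[qE|qM].
    left; have -> : a = fun=> ord_max by apply: alpha_full; rewrite -?qE.
    by apply/funext => i; apply: ord_inj; rewrite reflection_val subnn.
  exact: infinite_reflection a_le.
apply: lex_le_anti.
  apply: (value_le_lex_le q1 a_le); first exact: infinite_shift.
  by rewrite E1 a1.
apply: (value_le_lex_le q1 (tails_le_shift ra_le)).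
  exact: tail_gt0_infinite a_pos.
by rewrite E1 a1.
Qed.

(** * Approximation from below *)

Definition approx_below (R : realType) M (q : R) n (c : digits M) :=
  exists p, [/\ 1 < p, p < q & exists2 d, univoque_seqs M p d & agree n c d].

Lemma aperiodic_approx_below (R : realType) M (q : R) (c : digits M) n :
  1 < q -> q <= M.+1%:R -> ~ periodic_base M q ->
  tails_lex_le (alpha M q) c -> tails_lex_le (alpha M q) (reflection c) ->
  approx_below q n c.
Proof.
move=> q1 qM nper c_le rc_le; have [a1 a_le a_pos] := alphaP q1 qM.
have below m d : agree n c d -> tails_lt_in m (alpha M q) d ->
    tails_lt_in m (alpha M q) (reflection d) -> approx_below q n c.
  move=> cd d_lt rd_lt.
  have [p [p1 pq dU]] := tails_lt_in_univoque q1 a1 (a_pos m) d_lt rd_lt.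
  by exists p; split=> //; exists d.
have [nV|//|ra_lt] := alpha_cases q1 qM.
  have [m mP] := not_V_tails_lt_in q1 nV.
  have a_le1 : expansion_value q (alpha M q) <= 1 by rewrite a1.
  have c_val := tails_lex_value q1 a_le1 c_le.
  have rc_val := tails_lex_value q1 a_le1 rc_le.
  by apply: (below m c) => //; apply: mP; rewrite ?reflectionK.
have lex := alpha_shift_lex_le q1 qM.
have [m nm a_good] := good_prefixes lex (alpha_reflection_lt q1 qM ra_lt) n.+2.
case: m nm a_good => // m; rewrite ltnS => nm a_good.
have m0 : (0 < m)%N by apply: leq_trans nm.
have [d [cd d_lt rd_lt]] := lowered_approx m0 lex a_good c_le rc_le.
by apply: (below m.+1 d) => //; apply: agree_le cd; exact: ltnW.
Qed.

(** In a periodic base, univoque sequences avoid a prefix of [alpha M q], so no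
    modification is needed. *)
Lemma univoque_approx_below (R : realType) M (q : R) (c : digits M) n :
  1 < q -> q <= M.+1%:R -> univoque_seqs M q c -> approx_below q n c.
Proof.
move=> q1 qM cU; have [a1 a_le a_pos] := alphaP q1 qM.
have [[ra_le [k ak a_per]]|nper] := pselect (periodic_base M q).
  have avoid := univoque_avoids_prefix q1 a1 a_le ak a_per.
  have [p [p1 pq cUp]] := tails_lt_in_univoque q1 a1 (a_pos k.+1) (avoid _ cU)
    (avoid _ (univoque_reflection q1 cU)).
  by exists p; split=> //; exists c.
have lex (d : digits M) : univoque_seqs M q d -> tails_lex_le (alpha M q) d.
  move=> /(univoque_seqsP _ q1)[d_lt _] j /d_lt dj; right.
  by apply: (value_lt_lt_at q1 a_le); rewrite a1.
apply: aperiodic_approx_below => //; apply: lex => //.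
exact: univoque_reflection.
Qed.

Lemma V_approx_below (R : realType) M (q : R) (c : digits M) n :
  1 < q -> q <= M.+1%:R -> ~ periodic_base M q ->
  V_seqs M q c -> approx_below q n c.
Proof.
by move=> q1 qM nper /V_seqs_lexP[_ ? ?]; exact: aperiodic_approx_below.
Qed.

Lemma alpha_doubly_infinite (R : realType) M (q : R) : 1 < q -> q <= M.+1%:R ->
  periodic_base M q -> doubly_infinite (alpha M q).
Proof.
move=> q1 qM [_ [k ak a_per]]; have [a1 a_le a_pos] := alphaP q1 qM.
split; apply: (tail_gt0_infinite q1) => // n.
exact: reflection_tail_pos q1 a_per a_pos n.
Qed.

Lemma periodic_base_iff (R : realType) M (q : R) : 1 < q -> q <= M.+1%:R ->
  periodic_base M q <-> (V_bases M `\` closure (univoque_bases M)) q.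
Proof.
move=> q1 qM; have [a1 a_le a_pos] := alphaP q1 qM; split=> [per|[qV nU]].
  have [ra_le [k ak a_per]] := per; split.
    exact: V_bases_of_reflection ra_le (alpha_doubly_infinite q1 qM per).
  exact: periodic_not_closure ak a_per a_pos.
have [nV|//|ra_lt] := alpha_cases q1 qM.
  by case: nV; exact: V_bases_tails_le.
by case: nU; exact: alpha_strict_closure.
Qed.

Lemma big_base_not_V (R : realType) M (q : R) : 1 < q -> M.+1%:R < q ->
  ~ V_bases M q.
Proof.
by move=> q1 Mq [_ [c [[_ c1] _]]]; have := big_base_value c Mq q1; rewrite c1 ltxx.
Qed.

Lemma alpha_V_seqs (R : realType) M (q : R) : 1 < q -> q <= M.+1%:R ->
  periodic_base M q -> V_seqs M q (alpha M q).
Proof.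
move=> q1 qM per; have [a1 a_le a_pos] := alphaP q1 qM.
by apply/V_seqsP => //; split; [exact: (alpha_doubly_infinite q1 qM per).1| |case: per].
Qed.

Lemma big_base_univoque (R : realType) M (q : R) (c : digits M) : 1 < q ->
  M.+1%:R < q -> univoque_seqs M q c.
Proof.
move=> q1 Mq; apply/univoque_seqsP => //.
by split=> n _; exact: big_base_value.
Qed.

Lemma big_base_V_seqs (R : realType) M (q : R) (c : digits M) : 1 < q ->
  M.+1%:R <= q -> V_seqs M q c <-> seq_infinite c.
Proof.
move=> q1 Mq; rewrite (V_seqsP _ q1); split=> [[]//|c_inf].
have triv (d : digits M) : tails_le q d.
  move=> n _; apply: le_trans (expansion_value_le _ q1) _.
  by rewrite ler_pdivrMr ?subr_gt0// mul1r lerBrDr natr1.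
by [].
Qed.

Definition close_sets M n (A B : set (digits M)) :=
  forall c, A c -> exists2 d, B d & agree n c d.

Lemma close_sets_sub M n (A B : set (digits M)) : A `<=` B -> close_sets n A B.
Proof. by move=> AB c Ac; exists c => //; exact: AB. Qed.

Lemma close_sets_trans M n (A B C : set (digits M)) :
  close_sets n A B -> close_sets n B C -> close_sets n A C.
Proof.
move=> AB BC c /AB[d /BC[e Ce de] cd]; exists e => //; exact: agree_trans cd de.
Qed.

(** Only finitely many words of length [n] occur, so the base can be chosen
    uniformly in the sequence. *)
Lemma near_close_sets (R : realType) M n (F : set_system R)
    (A B : R -> set (digits M)) : Filter F ->
  (forall c0, \forall p \near F, (exists2 c, A p c & agree n c0 c) ->
     exists2 d, B p d & agree n c0 d) ->
  \forall p \near F, close_sets n (A p) (B p).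
Proof.
move=> FF cyl.
pose word (w : {ffun 'I_n -> 'I_M.+1}) : digits M :=
  fun i => if insub i is Some j then w j else ord0.
have := filter_forall FF (fun w => cyl (word w)).
apply: filterS => p H c Ac.
have cw : agree n (word [ffun i : 'I_n => c i]) c.
  by move=> i i_n; rewrite /word insubT ffunE.
have [|d Bd wd] := H [ffun i : 'I_n => c i]; first by exists c.
by exists d => //; apply: agree_trans wd; exact: agree_sym.
Qed.

Lemma near_left_base (R : realType) (q : R) : 1 < q ->
  \forall p \near q^'-, 1 < p /\ p < q.
Proof.
move=> q1; near=> p; split; near: p; [exact: nbhs_left_gt|exact: nbhs_left_lt].
Unshelve. all: by end_near. Qed.

Lemma near_close_below (R : realType) M n (q : R) (A : set (digits M)) : 1 < q ->
  (forall c, A c -> approx_below q n c) ->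
  \forall p \near q^'-, close_sets n A (univoque_seqs M p).
Proof.
move=> q1 below; apply: near_close_sets => c0.
have [[c Ac c0c]|nex] := pselect (exists2 c, A c & agree n c0 c); last first.
  by apply: nearW => p.
have [p0 [p01 p0q [d dU cd]]] := below c Ac.
near=> p => _; exists d; last exact: agree_trans c0c cd.
apply: (univoque_seqs_mono p01 _ dU).
by near: p; apply: nbhs_left_ge.
Unshelve. all: by end_near. Qed.

(** * Compactness and one-sided approximation *)

Lemma near_right_base (R : realType) (q b : R) : q < b ->
  \forall p \near q^'+, q < p /\ p < b.
Proof.
move=> qb; near=> p; split; near: p; [exact: nbhs_right_gt|exact: nbhs_right_lt].
Unshelve. all: by end_near. Qed.

Section Koenig.
Variables (R : realType) (M : nat) (q : R).
Hypotheses (q1 : 1 < q) (qM : q < M.+1%:R).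

Let inhabited n (x : digits M) :=
  forall p, q < p -> exists2 c, V_seqs M p c & agree n x c.

(** If every one-digit extension missed the sets for some base above [q], it
    would miss them for a base that serves all the finitely many digits. *)
Lemma inhabited_step n x : inhabited n x ->
  exists y, agree n x y /\ inhabited n.+1 y.
Proof.
move=> x_inh; apply: contrapT => nex.
pose upd (i : 'I_M.+1) : digits M := fun j => if j == n then i else x j.
have upd_agree i : agree n x (upd i).
  by move=> j jn; rewrite /upd ltn_eqF.
have empty i : exists2 p, q < p & forall c, V_seqs M p c -> ~ agree n.+1 (upd i) c.
  apply: contrapT => full; apply: nex; exists (upd i); split=> // p qp.
  apply: contrapT => none; apply: full; exists p => // c cV agr.
  by apply: none; exists c.
have : \forall p \near q^'+, q < p /\
    forall i c, V_seqs M p c -> ~ agree n.+1 (upd i) c.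
  near=> p; have qp : q < p by near: p; exact: nbhs_right_gt.
  split=> //; near: p; apply: filter_forall => i; have [p0 qp0 p0P] := empty i.
  apply: filterS (near_right_base qp0) => p [qp pp0] c cV.
  apply: p0P; apply: V_seqs_mono cV; last exact: ltW.
  exact: lt_trans q1 qp.
move=> /filter_ex[p [qp pP]]; have [c cV xc] := x_inh p qp.
apply: (pP (c n) c cV) => j; rewrite ltnS leq_eqVlt /upd => /predU1P[->|jn].
  by rewrite eqxx.
by rewrite ltn_eqF//; exact: xc.
Unshelve. all: by end_near. Qed.

(** The inequalities on values pass to the limit in the sequence and in the
    base. *)
Lemma V_seqs_limit (c : digits M) : (forall n, inhabited n c) -> V_seqs M q c.
Proof.
move=> c_inh.
have half (f : digits M -> digits M) :
    (forall n x y, agree n x y -> agree n (f x) (f y)) ->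
    (forall (p : R) d, 1 < p -> V_seqs M p d -> tails_le p (f d)) -> tails_le q (f c).
  move=> f_agree fV n fcn; apply/ler_addgt0Pr => e e0.
  have e2 : 0 < e / 2 by rewrite divr_gt0.
  have [N N_e] := exprV_small (M%:R / (q - 1)) q1 e2.
  have : \forall p \near q^'+, q < p /\ (1 < p /\ forall c : digits M,
      `|expansion_value p c - expansion_value q c| < e / 2).
    near=> p; split; near: p; first exact: nbhs_right_gt.
    by apply: cvg_within; exact: expansion_value_near.
  move=> /filter_ex[p [qp [p1 pe]]].
  have [d dV cd] := c_inh (n.+1 + N)%N p qp.
  have fcd := f_agree _ _ _ cd.
  have fdn : (f d n < M)%N by rewrite -fcd// ltn_addr.
  have := fV p d p1 dV n fdn.
  have := expansion_value_dist q1 (agree_shift fcd).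
  have := pe (shift n.+1 (f d)).
  by rewrite ltr_norml ler_norml => /andP[? ?] /andP[? ?]; lra.
have c_le : tails_le q c.
  by apply: (half id) => // p d p1 /(V_seqsP _ p1)[].
have rc_le : tails_le q (reflection c).
  apply: half => [n x y|p d p1 /(V_seqsP _ p1)[]//].
  exact: agree_reflection.
apply/V_seqsP => //; split=> //.
by rewrite -(reflectionK c); exact: infinite_reflection rc_le.
Unshelve. all: by end_near. Qed.

Lemma inhabited_V_seqs n x : inhabited n x ->
  exists2 c, V_seqs M q c & agree n x c.
Proof.
move=> x_inh.
have step (nx : nat * digits M) : exists y, inhabited nx.1 nx.2 ->
    agree nx.1 nx.2 y /\ inhabited nx.1.+1 y.
  have [inh|ninh] := pselect (inhabited nx.1 nx.2); last by exists nx.2.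
  by have [y yP] := inhabited_step inh; exists y.
have [f fP] := choice step.
pose xs := fix xs k := if k is k'.+1 then f ((n + k')%N, xs k') else x.
have xs_inh k : inhabited (n + k) (xs k).
  elim: k => [|k IH]; first by rewrite addn0.
  by rewrite addnS; exact: (fP (_, _) IH).2.
have xs_agree k j : agree (n + k) (xs k) (xs (k + j)%N).
  elim: j => [|j IH]; first by rewrite addn0.
  apply: agree_trans IH _; rewrite addnS.
  by apply: agree_le (fP (_, _) (xs_inh (k + j)%N)).1; rewrite /= leq_add2l leq_addr.
pose c : digits M := fun i => xs i.+1 i.
have xs_c k : agree (n + k) (xs k) c.
  move=> i i_nk; rewrite /c; have [ki|ik] := leqP k i.+1.
    by rewrite -(subnKC ki); exact: xs_agree.
  rewrite -(subnKC (ltnW ik)); apply/esym; apply: xs_agree.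
  by rewrite addnS ltnS leq_addl.
exists c; last by have := xs_c 0%N; rewrite addn0.
apply: V_seqs_limit => k p qp; have [d dV xd] := xs_inh k p qp.
exists d => //; apply: (@agree_le _ _ (n + k)%N); first exact: leq_addl.
by apply: agree_trans xd; apply: agree_sym; exact: xs_c.
Qed.
End Koenig.

Lemma V_seqs_right_close (R : realType) M (q : R) n : 1 < q ->
  \forall p \near q^'+, close_sets n (V_seqs M p) (V_seqs M q).
Proof.
move=> q1; have [qM|Mq] := ltP q M.+1%:R; last first.
  near=> p; have qp : q < p by near: p; exact: nbhs_right_gt.
  apply: close_sets_sub => c /big_base_V_seqs cV; apply/big_base_V_seqs => //.
  by apply: cV; [exact: lt_trans qp|exact: le_trans (ltW qp)].
apply: near_close_sets => c0.
have [inh|/existsNP[p0 /not_implyP[qp0 none]]] :=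
  pselect (forall p, q < p -> exists2 c, V_seqs M p c & agree n c0 c).
  by apply: nearW => p _; exact: inhabited_V_seqs inh.
apply: filterS (near_right_base qp0) => p [qp pp0] [c cV c0c].
case: none; exists c => //; apply: V_seqs_mono cV; last exact: ltW.
exact: lt_trans qp.
Unshelve. all: by end_near. Qed.

Definition close_along (R : realType) M (F : set_system R)
    (A : R -> set (digits M)) (q : R) :=
  forall n, \forall p \near F, close_sets n (A p) (A q) /\ close_sets n (A q) (A p).

Lemma univoque_left (R : realType) M (q : R) : 1 < q ->
  close_along q^'- (univoque_seqs M) q.
Proof.
move=> q1 n.
have below : \forall p \near q^'-,
    close_sets n (univoque_seqs M q) (univoque_seqs M p).
  have [qM|Mq] := leP q M.+1%:R.
    by apply: near_close_below => // c; exact: univoque_approx_below.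
  near=> p; apply: close_sets_sub => c _; apply: big_base_univoque.
    by near: p; exact: nbhs_left_gt.
  by near: p; exact: nbhs_left_gt.
near=> p; split; last by near: p.
have [p1 pq] : 1 < p /\ p < q by near: p; exact: near_left_base.
by apply: close_sets_sub; exact: univoque_seqs_mono p1 (ltW pq).
Unshelve. all: by end_near. Qed.

Lemma V_right (R : realType) M (q : R) : 1 < q ->
  close_along q^'+ (V_seqs M) q.
Proof.
move=> q1 n; near=> p; split; first by near: p; exact: V_seqs_right_close.
have qp : q < p by near: p; exact: nbhs_right_gt.
by apply: close_sets_sub; exact: V_seqs_mono q1 (ltW qp).
Unshelve. all: by end_near. Qed.

(** The inclusion holds below [M + 1]; from [M + 1] on, a sequence may fail to
    be infinite, but can be changed far away. *)
Lemma univoque_close_V (R : realType) M (p : R) n : 1 < p ->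
  close_sets n (univoque_seqs M p) (V_seqs M p).
Proof.
move=> p1; have [pM|Mp] := ltP p M.+1%:R.
  by apply: close_sets_sub; exact: univoque_sub_V_seqs.
move=> c _; have [M0|M_gt0] := posnP M.
  exists c => //; apply/big_base_V_seqs => //; left; apply/funext => i.
  by apply: ord_inj; have := leq_ord (c i); rewrite {2}M0 leqn0 => /eqP.
exists (cat_digits n c (fun=> ord_max)); last by apply: agree_sym; exact: agree_cat.
apply/big_base_V_seqs => //; right=> k; exists (k + n)%N; first exact: leq_addr.
rewrite /cat_digits ltnNge leq_addl/=; apply: contraTneq M_gt0.
by move=> /(congr1 (@nat_of_ord _))/= ->.
Qed.

Lemma near_dnbhs (R : realType) (q : R) (P : set R) :
  (\forall p \near q^'-, P p) -> (\forall p \near q^'+, P p) ->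
  \forall p \near q^', P p.
Proof.
move=> Pl Pr.
have {}Pl : nbhs q (fun p => p < q -> P p) by exact: Pl.
have {}Pr : nbhs q (fun p => q < p -> P p) by exact: Pr.
change (nbhs q (fun p => p != q -> P p)).
apply: filterS2 Pl Pr => p Pl Pr.
by case: (ltgtP p q) => [/Pl|/Pr|].
Qed.

Lemma near_left_of_dnbhs (R : realType) (q : R) (P : set R) :
  (\forall p \near q^', P p) -> \forall p \near q^'-, P p.
Proof.
move=> Pq; have {}Pq : nbhs q (fun p => p != q -> P p) by exact: Pq.
change (nbhs q (fun p => p < q -> P p)).
by apply: filterS Pq => p Pp pq; apply: Pp; rewrite lt_eqF.
Qed.

Lemma near_right_of_dnbhs (R : realType) (q : R) (P : set R) :
  (\forall p \near q^', P p) -> \forall p \near q^'+, P p.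
Proof.
move=> Pq; have {}Pq : nbhs q (fun p => p != q -> P p) by exact: Pq.
change (nbhs q (fun p => q < p -> P p)).
by apply: filterS Pq => p Pp pq; apply: Pp; rewrite gt_eqF.
Qed.

Lemma close_along_dnbhs (R : realType) M (A : R -> set (digits M)) q :
  close_along q^'- A q -> close_along q^'+ A q -> close_along q^' A q.
Proof. by move=> Al Ar n; exact: near_dnbhs. Qed.

(** Approximation by univoque sequences in bases below [q], which are close to
    [V_seqs] in the same base. *)
Lemma V_left (R : realType) M (q : R) : 1 < q -> ~ periodic_base M q ->
  close_along q^'- (V_seqs M) q.
Proof.
move=> q1 nper n.
have [qM|Mq] := leP q M.+1%:R; last first.
  near=> p; have Mp : M.+1%:R < p by near: p; exact: nbhs_left_gt.
  have p1 : 1 < p by near: p; exact: nbhs_left_gt.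
  by split; apply: close_sets_sub => c /(big_base_V_seqs _ _) H;
    apply/big_base_V_seqs => //; try exact: ltW; apply: H => //; exact: ltW.
have : \forall p \near q^'-, close_sets n (V_seqs M q) (univoque_seqs M p).
  by apply: near_close_below => // c; exact: V_approx_below.
move=> below; near=> p.
have [p1 pq] : 1 < p /\ p < q by near: p; exact: near_left_base.
split; first by apply: close_sets_sub; exact: V_seqs_mono p1 (ltW pq).
apply: (@close_sets_trans _ _ _ (univoque_seqs M p)); first by near: p.
exact: univoque_close_V.
Unshelve. all: by end_near. Qed.

(** Just above [q], univoque sequences are close to [V_seqs] at [q] by
    compactness, and these are approximated by univoque sequences from below. *)
Lemma univoque_right (R : realType) M (q : R) : 1 < q -> ~ periodic_base M q ->
  close_along q^'+ (univoque_seqs M) q.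
Proof.
move=> q1 nper n; near=> p.
have qp : q < p by near: p; exact: nbhs_right_gt.
split; last by apply: close_sets_sub; exact: univoque_seqs_mono q1 (ltW qp).
have [qM|Mq] := leP q M.+1%:R; last first.
  by apply: close_sets_sub => c _; exact: big_base_univoque.
apply: (@close_sets_trans _ _ _ (V_seqs M p)).
  by apply: univoque_close_V; exact: lt_trans qp.
apply: (@close_sets_trans _ _ _ (V_seqs M q)).
  by near: p; exact: V_seqs_right_close.
move=> c cV; have [p' [p'1 p'q [d dU cd]]] := V_approx_below n q1 qM nper cV.
by exists d => //; exact: univoque_seqs_mono p'1 (ltW p'q) _ dU.
Unshelve. all: by end_near. Qed.

(** * Hausdorff continuity *)

Definition within_dist (R : realType) (T : Type) (dist : T -> T -> R) r
    (A B : set T) := forall y, A y -> exists2 x, B x & dist x y < r.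

Lemma hausdorff_cvg0P (R : realType) (T : Type) (dist : T -> T -> R)
    (F : set_system R) (A : R -> set T) (B : set T) : Filter F ->
  (hausdorff_dist dist (A p) B @[p --> F] --> 0%E) <->
  (forall e : R, 0 < e -> \forall p \near F,
    within_dist dist e (A p) B /\ within_dist dist e B (A p)).
Proof.
move=> FF; split=> [cvgF e e0|near_e].
  have nbhs_e : nbhs (0%E : \bar R) [set y | (y < e%:E)%E].
    apply: open_nbhs_nbhs; split; first exact: open_ereal_lt_ereal.
    by rewrite /= lte_fin.
  have : \forall p \near F, (hausdorff_dist dist (A p) B < e%:E)%E.
    exact: cvgF nbhs_e.
  apply: filterS => p /ereal_inf_lt[_ [r [r0 [AB BA]] <-]].
  rewrite lte_fin => re.
  split=> y; [move=> /AB|move=> /BA] => -[x Bx /= xy]; exists x => //;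
    exact: lt_trans re.
move=> X [e /= e0 eX].
have e2 : 0 < e / 2 by rewrite divr_gt0.
apply: filterS (near_e _ e2) => p [AB BA] /=.
have ge0 : (0 <= hausdorff_dist dist (A p) B)%E.
  by apply/ereal_infP => _ [r [r0 _] <-]; rewrite lee_fin ltW.
have le_e : (hausdorff_dist dist (A p) B <= (e / 2)%:E)%E.
  apply: ereal_inf_lbound; by exists (e / 2).
have fin : hausdorff_dist dist (A p) B \is a fin_num.
  by rewrite ge0_fin_numE// (le_lt_trans le_e)// ltry.
rewrite -(fineK fin); apply: eX; rewrite /ball/= sub0r normrN.
move: ge0 le_e; rewrite -(fineK fin) !lee_fin => ge0 le_e.
rewrite ger0_norm//; apply: le_lt_trans le_e _; lra.
Qed.

Lemma rho_agree (R : realType) M n (c d : digits M) :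
  agree n c d -> rho R c d < 2 ^- n.
Proof.
move=> cd; rewrite /rho; case: pselect => [ex|_]; last first.
  by rewrite invr_gt0 exprn_gt0.
case: (ex_minnP ex) => k cdk _.
rewrite ltf_pV2 ?posrE ?exprn_gt0// ltr_eXn2l ?ltr1n// ltnS leqNgt.
by apply: contra cdk => /cd ->.
Qed.

Lemma agree_rho (R : realType) M n (c d : digits M) :
  rho R c d < 2 ^- n -> agree n c d.
Proof.
rewrite /rho; case: pselect => [ex|nex _]; last first.
  move=> i _; apply/eqP; apply: contrapT => /negP cdi; apply: nex; by exists i.
case: (ex_minnP ex) => k _ min_k.
rewrite ltf_pV2 ?posrE ?exprn_gt0// ltr_eXn2l ?ltr1n// ltnS => nk i i_n.
apply/eqP; apply: contraLR i_n => /min_k ki; rewrite -leqNgt.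
exact: leq_trans ki.
Qed.

Lemma close_along_rho (R : realType) M (F : set_system R)
    (A : R -> set (digits M)) q : Filter F -> close_along F A q <->
  hausdorff_dist (@rho R M) (A p) (A q) @[p --> F] --> 0%E.
Proof.
move=> FF; rewrite hausdorff_cvg0P; split=> [cl e e0|near_e n].
  have [n n_e] := exprV_small 1 (ltr1n R 2) e0.
  rewrite mul1r in n_e.
  apply: filterS (cl n) => p [AB BA].
  split=> y; [move=> /AB|move=> /BA] => -[x Bx /agree_sym/(rho_agree R) xy];
    exists x => //; exact: lt_trans n_e.
have n0 : (0 : R) < 2 ^- n by rewrite invr_gt0 exprn_gt0.
apply: filterS (near_e _ n0) => p [AB BA].
by split=> y; [move=> /AB|move=> /BA] => -[x Bx /agree_rho/agree_sym xy];
  exists x.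
Qed.

Definition values (R : realType) M (A : R -> set (digits M)) (q : R) : set R :=
  [set expansion_value q c | c in A q].

Lemma univoque_set_values (R : realType) M :
  @univoque_set R M = values (univoque_seqs M).
Proof.
apply/funext => q; apply/seteqP; split=> [x [c [cx uniq_c]]|_ [c cU <-]//].
by exists c => //; exists c; rewrite cx.
Qed.

Lemma close_along_values (R : realType) M (F : set_system R)
    (A : R -> set (digits M)) (q : R) : Filter F -> F --> q -> 1 < q ->
  close_along F A q ->
  hausdorff_dist (@real_dist R) (values A p) (values A q) @[p --> F] --> 0%E.
Proof.
move=> FF Fq q1 cl; apply/hausdorff_cvg0P => e e0.
have e2 : 0 < e / 2 by rewrite divr_gt0.
have [n n_e] := exprV_small (M%:R / (q - 1)) q1 e2.
apply: filterS2 (cl n) (Fq _ (@expansion_value_near R M q _ q1 e2)).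
move=> p [AB BA] [p1 pe]; split=> _ [c Ac <-].
  have [d Ad cd] := AB c Ac; exists (expansion_value q d); first by exists d.
  have := pe c; have := expansion_value_dist q1 cd.
  rewrite /real_dist !ltr_norml ler_norml => /andP[? ?] /andP[? ?].
  by apply/andP; split; lra.
have [d Ad cd] := BA c Ac; exists (expansion_value p d); first by exists d.
have := pe d; have := expansion_value_dist q1 cd.
rewrite /real_dist !ltr_norml ler_norml => /andP[? ?] /andP[? ?].
by apply/andP; split; lra.
Qed.

(** The expansion [alpha M q] becomes univoque in all bases above [q]. *)
Lemma periodic_univoque_jump (R : realType) M (q : R) : 1 < q -> q <= M.+1%:R ->
  periodic_base M q -> ~ close_along q^'+ (univoque_seqs M) q.
Proof.
move=> q1 qM per; have [a1 a_le a_pos] := alphaP q1 qM.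
have [_ [k ak a_per]] := per.
move=> /(_ (k.+1 + k.+1)%N) cl.
have /filter_ex[p [qp [cl_p _]]] : \forall p \near q^'+, q < p /\
    (close_sets (k.+1 + k.+1) (univoque_seqs M p) (univoque_seqs M q) /\
     close_sets (k.+1 + k.+1) (univoque_seqs M q) (univoque_seqs M p)).
  by apply: filterI => //; exact: nbhs_right_gt.
have [d dU ad] :=
  cl_p _ (V_seqs_sub_univoque q1 qp (alpha_V_seqs q1 qM per)).
exact: (univoque_not_agree q1 a1 ak a_per dU) (agree_sym ad).
Qed.

(** In bases below [q], all sequences of [V_seqs] are univoque in base [q], far
    from [alpha M q]. *)
Lemma periodic_V_jump (R : realType) M (q : R) : 1 < q -> q <= M.+1%:R ->
  periodic_base M q -> ~ close_along q^'- (V_seqs M) q.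
Proof.
move=> q1 qM per; have [a1 a_le a_pos] := alphaP q1 qM.
have [_ [k ak a_per]] := per.
move=> /(_ (k.+1 + k.+1)%N) cl.
have /filter_ex[p [[p1 pq] [_ cl_p]]] : \forall p \near q^'-, (1 < p /\ p < q) /\
    (close_sets (k.+1 + k.+1) (V_seqs M p) (V_seqs M q) /\
     close_sets (k.+1 + k.+1) (V_seqs M q) (V_seqs M p)).
  by apply: filterI => //; exact: near_left_base.
have [d dV ad] := cl_p _ (alpha_V_seqs q1 qM per).
apply: (univoque_not_agree q1 a1 ak a_per _ (agree_sym ad)).
exact: V_seqs_sub_univoque p1 pq _ dV.
Qed.

Lemma periodic_univoque_set_jump (R : realType) M (q : R) : 1 < q ->
  q <= M.+1%:R -> periodic_base M q ->
  ~ hausdorff_right_continuous_at (@real_dist R) (values (univoque_seqs M)) q.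
Proof.
move=> q1 qM per; have [a1 a_le a_pos] := alphaP q1 qM.
have [_ [k ak a_per]] := per.
have [e e0 gap] := periodic_value_gap q1 a1 ak a_per a_pos.
have e2 : 0 < e / 2 by rewrite divr_gt0.
move=> /hausdorff_cvg0P-/(_ _ e2) cl.
have : \forall p \near q^'+, [/\ q < p, forall c : digits M,
    `|expansion_value p c - expansion_value q c| < e / 2 &
    within_dist (@real_dist R) (e / 2) (values (univoque_seqs M) p)
      (values (univoque_seqs M) q)].
  have nearq : \forall p \near q^'+, 1 < p /\ forall c : digits M,
      `|expansion_value p c - expansion_value q c| < e / 2.
    by apply: cvg_within; exact: expansion_value_near.
  apply: filterS3 (@nbhs_right_gt R q) nearq cl.
  by move=> p qp [_ pe] [].
move=> /filter_ex[p [qp pe cl_p]].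
have [|_ [c cU <-]] := cl_p (expansion_value p (alpha M q)).
  exists (alpha M q) => //.
  exact: (V_seqs_sub_univoque q1 qp (alpha_V_seqs q1 qM per)).
have := pe (alpha M q); have := gap c cU.
rewrite a1 /real_dist leNgt => /negP nlt; rewrite !ltr_norml.
move=> /andP[? ?] /andP[? ?]; apply: nlt; rewrite ltr_norml.
by apply/andP; split; lra.
Qed.

Lemma periodic_V_set_jump (R : realType) M (q : R) : 1 < q ->
  q <= M.+1%:R -> periodic_base M q ->
  ~ hausdorff_left_continuous_at (@real_dist R) (values (V_seqs M)) q.
Proof.
move=> q1 qM per; have [a1 a_le a_pos] := alphaP q1 qM.
have [_ [k ak a_per]] := per.
have [e e0 gap] := periodic_value_gap q1 a1 ak a_per a_pos.
have e2 : 0 < e / 2 by rewrite divr_gt0.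
move=> /hausdorff_cvg0P-/(_ _ e2) cl.
have : \forall p \near q^'-, [/\ 1 < p /\ p < q, forall c : digits M,
    `|expansion_value p c - expansion_value q c| < e / 2 &
    within_dist (@real_dist R) (e / 2) (values (V_seqs M) q)
      (values (V_seqs M) p)].
  have nearq : \forall p \near q^'-, 1 < p /\ forall c : digits M,
      `|expansion_value p c - expansion_value q c| < e / 2.
    by apply: cvg_within; exact: expansion_value_near.
  apply: filterS3 (near_left_base q1) nearq cl.
  by move=> p p1q [_ pe] [].
move=> /filter_ex[p [[p1 pq] pe cl_p]].
have [|_ [c cV <-]] := cl_p (expansion_value q (alpha M q)).
  by exists (alpha M q) => //; exact: alpha_V_seqs.
have := pe c; have := gap c (V_seqs_sub_univoque p1 pq cV).
rewrite a1 /real_dist leNgt => /negP nlt; rewrite !ltr_norml.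
move=> /andP[? ?] /andP[? ?]; apply: nlt; rewrite ltr_norml.
by apply/andP; split; lra.
Qed.

Lemma continuous_left (R : realType) T (dist : T -> T -> R) (A : R -> set T) q :
  hausdorff_continuous_at dist A q -> hausdorff_left_continuous_at dist A q.
Proof.
by move=> cont X /cont; exact: near_left_of_dnbhs.
Qed.

Lemma continuous_right (R : realType) T (dist : T -> T -> R) (A : R -> set T) q :
  hausdorff_continuous_at dist A q -> hausdorff_right_continuous_at dist A q.
Proof.
by move=> cont X /cont; exact: near_right_of_dnbhs.
Qed.

Lemma periodic_base_le (R : realType) M (q : R) : 1 < q ->
  periodic_base M q -> q <= M.+1%:R.
Proof.
move=> q1 [_ [k ak a_per]]; rewrite leNgt; apply/negP => /ltW Mq.
move: ak (congr1 (fun c : digits M => c 0%N : nat) a_per).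
by rewrite alpha_full// /Defs.shift reflection_val/= subnn => M0 ME; rewrite -ME in M0.
Qed.

Theorem theorem1 (R : realType) (M : nat) (hM : (0 < M)%N) :
  (forall q : R, 1 < q ->
     hausdorff_left_continuous_at (@rho R M) (@univoque_seqs R M) q /\
     hausdorff_left_continuous_at (@real_dist R) (@univoque_set R M) q) /\
  (forall q : R, 1 < q ->
     hausdorff_right_continuous_at (@rho R M) (@V_seqs R M) q /\
     hausdorff_right_continuous_at (@real_dist R) (@V_set R M) q) /\
  (forall q : R, 1 < q ->
     let regular := ~ (V_bases M `\` closure (univoque_bases M)) q in
     (hausdorff_continuous_at (@rho R M) (@univoque_seqs R M) q <-> regular) /\
     (hausdorff_continuous_at (@real_dist R) (@univoque_set R M) q <-> regular) /\
     (hausdorff_continuous_at (@rho R M) (@V_seqs R M) q <-> regular) /\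
     (hausdorff_continuous_at (@real_dist R) (@V_set R M) q <-> regular)).
Proof.
have VE : @V_set R M = values (V_seqs M) by [].
rewrite univoque_set_values VE; split; [|split] => q q1.
- have cl := univoque_left M q1; split; first exact/close_along_rho.
  by apply: close_along_values => //; exact: cvg_within.
- have cl := V_right M q1; split; first exact/close_along_rho.
  by apply: close_along_values => //; exact: cvg_within.
have [per|nper] := pselect (periodic_base M q).
  have qM := periodic_base_le q1 per.
  have irregular := (periodic_base_iff q1 qM).1 per.
  split; last split; last split; split=> [cont|/(_ irregular)//] _.
  - by apply: (periodic_univoque_jump q1 qM per); apply/close_along_rho;
      exact: continuous_right.
  - by apply: (periodic_univoque_set_jump q1 qM per); exact: continuous_right.
  - by apply: (periodic_V_jump q1 qM per); apply/close_along_rho;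
      exact: continuous_left.
  - by apply: (periodic_V_set_jump q1 qM per); exact: continuous_left.
have regular : ~ (V_bases M `\` closure (univoque_bases M)) q.
  have [qM|Mq] := leP q M.+1%:R; last by case=> /(big_base_not_V q1 Mq).
  by move=> /(periodic_base_iff q1 qM).
have clU : close_along q^' (univoque_seqs M) q.
  by apply: close_along_dnbhs; [exact: univoque_left|exact: univoque_right].
have clV : close_along q^' (V_seqs M) q.
  by apply: close_along_dnbhs; [exact: V_left|exact: V_right].
split; last split; last split; split=> // _.
- exact/close_along_rho.
- by apply: close_along_values => //; exact: cvg_within.
- exact/close_along_rho.
- by apply: close_along_values => //; exact: cvg_within.
Qed.
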